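(* There exists an algorithm which, given as input a finite set $\mathcal{L}$ of $n$ $l$'s (each specified by the coordinates of its corner and the endpoints of its two arms), runs in $O(n(\log n)^2)$ time and outputs an independent set $I\subseteq\mathcal{L}$ of the intersection graph of $\mathcal{L}$ with $|I|\ \ge\ \alpha/(36\log(2d_x)\log(2d_y))$, where $\alpha$ is the maximum size of an independent set of that intersection graph, $d_x=d^x_{max}(\mathcal{L})/d^x_{min}(\mathcal{L})$, $d_y=d^y_{max}(\mathcal{L})/d^y_{min}(\mathcal{L})$, and $\log$ is to base 2.
   Context: An $l$ is a planar object which is the union of a horizontal and a vertical line segment (its two arms) of positive length sharing a common endpoint (its corner), in one of the four shapes $\llcorner$, $\ulcorner$, $\urcorner$, $\lrcorner$; e.g. an $l$ of shape $\llcorner$ with corner $(x_c,y_c)$ is the point set $\{(x,y_c): x_c\le x\le x_h\}\cup\{(x_c,y): y_c\le y\le y_v\}$ with $x_h>x_c$, $y_v>y_c$, and the other shapes are its rotations. The two arms of an $l$ may have different lengths. $d^x_{max}(\mathcal{L})$ and $d^x_{min}(\mathcal{L})$ denote the maximum and minimum length of the horizontal arm over members of $\mathcal{L}$; $d^y_{max}(\mathcal{L})$ and $d^y_{min}(\mathcal{L})$ are defined similarly for vertical arms. Two distinct $l$'s intersect if their point sets have a common point; the intersection graph of $\mathcal{L}$ has vertex set $\mathcal{L}$ and an edge between every intersecting pair (such graphs are the $B_1$-VPG graphs). An independent set is a subset of $\mathcal{L}$ no two members of which intersect. *)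

(* Defs.v *)
From HB Require Import structures.
From mathcomp Require Import all_boot all_order all_algebra.
From mathcomp Require Import boolp classical_sets reals topology normedtype.
From mathcomp Require Import landau sequences exp.

Set Implicit Arguments.
Unset Strict Implicit.
Unset Printing Implicit Defensive.

Import Order.TTheory GRing.Theory Num.Theory.
Import numFieldNormedType.Exports.

Local Open Scope ring_scope.
Local Open Scope classical_set_scope.

Definition log2 (R : realType) (x : R) : R := ln x / ln 2.

(** * L-shaped objects and their intersection graph *)

(* The corner is (ell_x, ell_y); the horizontal arm ends at (ell_xh, ell_y) and
   the vertical arm at (ell_x, ell_yv). The signs of ell_xh - ell_x and
   ell_yv - ell_y give the four shapes; both differences are nonzero since the
   arms have positive length. *)
Record ell (R : realType) := Ell {
  ell_x : R;
  ell_y : R;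
  ell_xh : R;
  ell_yv : R;
  ell_xhP : ell_xh != ell_x;
  ell_yvP : ell_yv != ell_y
}.

Definition horizontal_arm (R : realType) (l : ell R) : set (R * R) :=
  [set p | Num.min (ell_x l) (ell_xh l) <= p.1 <= Num.max (ell_x l) (ell_xh l)
           /\ p.2 = ell_y l].

Definition vertical_arm (R : realType) (l : ell R) : set (R * R) :=
  [set p | p.1 = ell_x l
           /\ Num.min (ell_y l) (ell_yv l) <= p.2 <= Num.max (ell_y l) (ell_yv l)].

Definition ell_points (R : realType) (l : ell R) : set (R * R) :=
  horizontal_arm l `|` vertical_arm l.

Definition horizontal_length (R : realType) (l : ell R) : R :=
  `|ell_xh l - ell_x l|.

Definition vertical_length (R : realType) (l : ell R) : R :=
  `|ell_yv l - ell_y l|.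

(* A set of n l's is an injective family L indexed by 'I_n. *)
Definition intersection_graph (R : realType) (n : nat) (L : 'I_n -> ell R) :
    rel 'I_n :=
  fun i j => (i != j) && `[< ell_points (L i) `&` ell_points (L j) !=set0 >].

Definition independent (V : finType) (e : rel V) (I : {set V}) : bool :=
  [forall i in I, forall j in I, ~~ e i j].

Definition independence_number (V : finType) (e : rel V) : nat :=
  \max_(I : {set V} | independent e I) #|I|.

(* These are the maximum and minimum of a nonempty family of nonnegative numbers:
   the defaults 0 and family_max f change neither. *)
Definition family_max (R : realType) (n : nat) (f : 'I_n -> R) : R :=
  \big[Num.max/0]_(i < n) f i.

Definition family_min (R : realType) (n : nat) (f : 'I_n -> R) : R :=
  \big[Num.min/family_max f]_(i < n) f i.

(* For n = 0 these ratios are 0 / 0 = 0. *)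
Definition d_x (R : realType) (n : nat) (L : 'I_n -> ell R) : R :=
  family_max (fun i => horizontal_length (L i))
  / family_min (fun i => horizontal_length (L i)).

Definition d_y (R : realType) (n : nat) (L : 'I_n -> ell R) : R :=
  family_max (fun i => vertical_length (L i))
  / family_min (fun i => vertical_length (L i)).

(** * Real RAM *)

(* Algorithms are structured programs on a unit-cost real RAM. The memory has
   integer and real registers, and integer and real arrays; registers and
   arrays are named by constants of the program, cells are addressed by computed
   integers. Reals support field operations and comparisons only: there is no
   rounding and no conversion from reals to integers. Integers support addition,
   truncated subtraction, halving and comparisons, and every integer written to
   memory must fit in a machine word. The syntax contains no real constant other
   than natural numbers and does not depend on the input size. *)

Inductive iexp : Type :=
| IConst of nat
| IReg of nat
| IGet of nat & iexp                (* array name, index *)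
| IAdd of iexp & iexp
| ISub of iexp & iexp
| IHalf of iexp.

Inductive rexp : Type :=
| RConst of nat
| RReg of nat
| RGet of nat & iexp                (* array name, index *)
| RAdd of rexp & rexp
| RSub of rexp & rexp
| RMul of rexp & rexp
| RDiv of rexp & rexp.

Inductive bexp : Type :=
| ILe of iexp & iexp
| RLe of rexp & rexp
| BNot of bexp
| BAnd of bexp & bexp.

Inductive com : Type :=
| CSkip
| CIReg of nat & iexp
| CRReg of nat & rexp
| CISet of nat & iexp & iexp        (* array name, index, value *)
| CRSet of nat & iexp & rexp        (* array name, index, value *)
| CSeq of com & com
| CIf of bexp & com & com
| CWhile of bexp & com.

Record state (R : realType) := State {
  ireg : nat -> nat;
  rreg : nat -> R;
  iarr : nat -> nat -> nat;
  rarr : nat -> nat -> R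
}.

Definition upd (A : Type) (f : nat -> A) (k : nat) (v : A) : nat -> A :=
  fun k' => if k' == k then v else f k'.

Definition upd2 (A : Type) (f : nat -> nat -> A) (a k : nat) (v : A) :
    nat -> nat -> A :=
  upd f a (upd (f a) k v).

Section Semantics.
Variable R : realType.
Implicit Type s : state R.

Fixpoint ieval s (e : iexp) : nat :=
  match e with
  | IConst k => k
  | IReg x => ireg s x
  | IGet a e1 => iarr s a (ieval s e1)
  | IAdd e1 e2 => (ieval s e1 + ieval s e2)%N
  | ISub e1 e2 => (ieval s e1 - ieval s e2)%N
  | IHalf e1 => (ieval s e1)./2
  end.

Fixpoint reval s (e : rexp) : R :=
  match e with
  | RConst k => k%:R
  | RReg x => rreg s x
  | RGet a e1 => rarr s a (ieval s e1)
  | RAdd e1 e2 => reval s e1 + reval s e2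
  | RSub e1 e2 => reval s e1 - reval s e2
  | RMul e1 e2 => reval s e1 * reval s e2
  | RDiv e1 e2 => reval s e1 / reval s e2
  end.

Fixpoint beval s (b : bexp) : bool :=
  match b with
  | ILe e1 e2 => (ieval s e1 <= ieval s e2)%N
  | RLe e1 e2 => reval s e1 <= reval s e2
  | BNot b1 => ~~ beval s b1
  | BAnd b1 b2 => beval s b1 && beval s b2
  end.

Definition set_ireg s x v := State (upd (ireg s) x v) (rreg s) (iarr s) (rarr s).
Definition set_rreg s x v := State (ireg s) (upd (rreg s) x v) (iarr s) (rarr s).
Definition set_iarr s a k v :=
  State (ireg s) (rreg s) (upd2 (iarr s) a k v) (rarr s).
Definition set_rarr s a k v :=
  State (ireg s) (rreg s) (iarr s) (upd2 (rarr s) a k v).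

End Semantics.

(* Every constant, memory access, operation and comparison costs one unit. *)

Fixpoint icost (e : iexp) : nat :=
  match e with
  | IConst _ | IReg _ => 1
  | IGet _ e1 | IHalf e1 => (icost e1).+1
  | IAdd e1 e2 | ISub e1 e2 => (icost e1 + icost e2).+1
  end.

Fixpoint rcost (e : rexp) : nat :=
  match e with
  | RConst _ | RReg _ => 1
  | RGet _ e1 => (icost e1).+1
  | RAdd e1 e2 | RSub e1 e2 | RMul e1 e2 | RDiv e1 e2 =>
      (rcost e1 + rcost e2).+1
  end.

Fixpoint bcost (b : bexp) : nat :=
  match b with
  | ILe e1 e2 => (icost e1 + icost e2).+1
  | RLe e1 e2 => (rcost e1 + rcost e2).+1
  | BNot b1 => (bcost b1).+1
  | BAnd b1 b2 => (bcost b1 + bcost b2).+1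
  end.

(* exec w p s t s': started in s, the program p halts in state s' after exactly
   t steps, and every integer it writes is at most w. *)
Inductive exec (R : realType) (w : nat) :
    com -> state R -> nat -> state R -> Prop :=
| ExecSkip s : exec w CSkip s 1 s
| ExecIReg s x e : (ieval s e <= w)%N ->
    exec w (CIReg x e) s (icost e).+1 (set_ireg s x (ieval s e))
| ExecRReg s x e :
    exec w (CRReg x e) s (rcost e).+1 (set_rreg s x (reval s e))
| ExecISet s a k e : (ieval s e <= w)%N ->
    exec w (CISet a k e) s (icost k + icost e).+1
      (set_iarr s a (ieval s k) (ieval s e))
| ExecRSet s a k e :
    exec w (CRSet a k e) s (icost k + rcost e).+1
      (set_rarr s a (ieval s k) (reval s e))
| ExecSeq c1 c2 s1 s2 s3 t1 t2 :
    exec w c1 s1 t1 s2 -> exec w c2 s2 t2 s3 ->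
    exec w (CSeq c1 c2) s1 (t1 + t2) s3
| ExecIfTrue b c1 c2 s s' t :
    beval s b -> exec w c1 s t s' ->
    exec w (CIf b c1 c2) s (bcost b + t).+1 s'
| ExecIfFalse b c1 c2 s s' t :
    ~~ beval s b -> exec w c2 s t s' ->
    exec w (CIf b c1 c2) s (bcost b + t).+1 s'
| ExecWhileFalse b c s :
    ~~ beval s b -> exec w (CWhile b c) s (bcost b).+1 s
| ExecWhileTrue b c s1 s2 s3 t1 t2 :
    beval s1 b -> exec w c s1 t1 s2 -> exec w (CWhile b c) s2 t2 s3 ->
    exec w (CWhile b c) s1 (bcost b + t1 + t2).+1 s3.

(* Initial memory: integer register 0 holds n, real arrays 0, 1, 2, 3 hold the
   coordinates of the n corners and arm endpoints, all the rest is 0. The two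
   remaining endpoint coordinates are those of the corner. *)
Definition input_coord (R : realType) (a : nat) (l : ell R) : R :=
  match a with
  | 0 => ell_x l
  | 1 => ell_y l
  | 2 => ell_xh l
  | 3 => ell_yv l
  | _ => 0
  end.

Definition input_state (R : realType) (n : nat) (L : 'I_n -> ell R) : state R :=
  State (upd (fun=> 0%N) 0 n)
        (fun=> 0)
        (fun _ _ => 0%N)
        (fun a k => if insub k is Some i then input_coord a (L i) else 0).

(* The output is the set whose characteristic vector is in integer array 0. *)
Definition output_set (R : realType) (n : nat) (s : state R) : {set 'I_n} :=
  [set i : 'I_n | iarr s 0 i != 0%N].

(* Main.v *)
Require Import Defs.
From HB Require Import structures.
From mathcomp Require Import all_boot all_order all_algebra.
From mathcomp Require Import boolp classical_sets reals topology normedtype.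
From mathcomp Require Import landau sequences exp.
From mathcomp Require Import zify lra.

Set Implicit Arguments.
Unset Strict Implicit.
Unset Printing Implicit Defensive.

Import Order.TTheory GRing.Theory Num.Theory.
Import numFieldNormedType.Exports.

(* Greedily split the l's by doubling lengths of their horizontal arms: every new
   class starts at the shortest remaining arm and extends to twice its length [a],
   so there are at most log2 (2 d_x) classes. Split each class greedily into
   vertical strips of width [a] and number the strips modulo 3, so that different
   strips of one class and one residue start at least [3 a] apart and l's of the same
   shape in them cannot meet. Do the same for vertical arms. Together with the four shapes this
   gives at most 36 log2 (2 d_x) log2 (2 d_y) groups, each a union of mutually
   disjoint cells (a strip in both directions). Inside a cell two l's are disjoint
   exactly when they are strictly comparable for the product of two orders, so an
   independent subset of a group is a chain. One longest chain computation treats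
   all groups: in the first order groups are sorted upwards, in the second one
   downwards, so that every chain stays in one group. A longest chain is at least
   as large as every intersection of an independent set with a group.

   Neither floors nor logarithms of reals are needed, and the program never writes
   a real number. Items are sorted with a tournament tree, the longest chain is
   found by patience sorting with binary search. *)

(** * Programs and their running times *)

Section Hoare.
Local Open Scope nat_scope.
Variables (R : realType) (w : nat).
Implicit Types (s : state R) (c : com) (Q : state R -> Prop).

Definition runs c s t Q := exists t' s', [/\ exec w c s t' s', t' <= t & Q s'].

Fixpoint regs_written c : seq nat :=
  match c with
  | CIReg x _ => [:: x]
  | CSeq c1 c2 | CIf _ c1 c2 => regs_written c1 ++ regs_written c2
  | CWhile _ c1 => regs_written c1
  | _ => [::]
  end.

Fixpoint arrs_written c : seq nat :=
  match c with
  | CISet a _ _ => [:: a]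
  | CSeq c1 c2 | CIf _ c1 c2 => arrs_written c1 ++ arrs_written c2
  | CWhile _ c1 => arrs_written c1
  | _ => [::]
  end.

Fixpoint keeps_reals c : bool :=
  match c with
  | CRReg _ _ | CRSet _ _ _ => false
  | CSeq c1 c2 | CIf _ c1 c2 => keeps_reals c1 && keeps_reals c2
  | CWhile _ c1 => keeps_reals c1
  | _ => true
  end.

Definition frame (D E : seq nat) s s' :=
  [/\ rarr s' = rarr s, (forall x, x \notin D -> ireg s' x = ireg s x)
    & (forall a, a \notin E -> iarr s' a = iarr s a)].

Definition framed c := frame (regs_written c) (arrs_written c).

Lemma frame_refl D E s : frame D E s s.
Proof. by []. Qed.

Lemma frame_trans D E s1 s2 s3 :
  frame D E s1 s2 -> frame D E s2 s3 -> frame D E s1 s3.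
Proof.
move=> [r1 i1 a1] [r2 i2 a2]; split; first by rewrite r2.
- by move=> x xD; rewrite i2 ?i1.
- by move=> x xD; rewrite a2 ?a1.
Qed.

Lemma frame_sub D E D' E' s s' :
  {subset D <= D'} -> {subset E <= E'} -> frame D E s s' -> frame D' E' s s'.
Proof.
move=> DD EE [r i a]; split=> // x xn; [apply: i|apply: a]; apply: contra xn.
  exact: DD.
exact: EE.
Qed.

Lemma exec_framed c s t s' : exec w c s t s' -> keeps_reals c -> framed c s s'.
Proof.
have subl (A B : seq nat) : {subset A <= A ++ B}.
  by move=> x; rewrite mem_cat => ->.
have subr (A B : seq nat) : {subset B <= A ++ B}.
  by move=> x; rewrite mem_cat => ->; rewrite orbT.
elim=> {c s t s'} //=.
- by move=> s x e _ _; split=> //= y; rewrite inE /upd => /negPf ->.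
- by move=> s a k e _ _; split=> //= y; rewrite inE /upd2 /upd => /negPf ->.
- move=> c1 c2 s1 s2 s3 _ _ _ IH1 _ IH2 /andP[k1 k2].
  apply: (@frame_trans _ _ _ s2).
    by apply: frame_sub (IH1 k1); apply: subl.
  by apply: frame_sub (IH2 k2); apply: subr.
- move=> b c1 c2 s s' _ _ _ IH /andP[k1 k2].
  by apply: frame_sub (IH k1); apply: subl.
- move=> b c1 c2 s s' _ _ _ IH /andP[k1 k2].
  by apply: frame_sub (IH k2); apply: subr.
- move=> b c s1 s2 s3 _ _ _ _ IH1 _ IH2 k.
  exact: frame_trans (IH1 k) (IH2 k).
Qed.

Lemma runs_weaken c s t t' Q Q' :
  runs c s t Q -> t <= t' -> (forall s', Q s' -> Q' s') -> runs c s t' Q'.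
Proof.
move=> [t1 [s1 [e le1 q]]] le2 imp; exists t1, s1; split=> //.
  exact: leq_trans le1 le2.
exact: imp.
Qed.

Lemma runs_framed c s t Q : keeps_reals c ->
  runs c s t Q -> runs c s t (fun s' => framed c s s' /\ Q s').
Proof.
move=> kc [t1 [s1 [e le1 q]]]; exists t1, s1; split=> //; split=> //.
exact: exec_framed e kc.
Qed.

(* For programs without loops only: a loop satisfies no [wp] and has a junk cost. *)
Fixpoint wp c Q s : Prop :=
  match c with
  | CSkip => Q s
  | CIReg x e => ieval s e <= w /\ Q (set_ireg s x (ieval s e))
  | CRReg x e => Q (set_rreg s x (reval s e))
  | CISet a k e => ieval s e <= w /\ Q (set_iarr s a (ieval s k) (ieval s e))
  | CRSet a k e => Q (set_rarr s a (ieval s k) (reval s e))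
  | CSeq c1 c2 => wp c1 (wp c2 Q) s
  | CIf b c1 c2 =>
      (beval s b -> wp c1 Q s) /\ (~~ beval s b -> wp c2 Q s)
  | CWhile _ _ => False
  end.

Fixpoint straight_cost c : nat :=
  match c with
  | CSkip | CWhile _ _ => 1
  | CIReg _ e => (icost e).+1
  | CRReg _ e => (rcost e).+1
  | CISet _ k e => (icost k + icost e).+1
  | CRSet _ k e => (icost k + rcost e).+1
  | CSeq c1 c2 => straight_cost c1 + straight_cost c2
  | CIf b c1 c2 => (bcost b + maxn (straight_cost c1) (straight_cost c2)).+1
  end.

Lemma runs_seq c1 c2 s t1 t2 Q :
  runs c1 s t1 (fun s1 => runs c2 s1 t2 Q) -> runs (CSeq c1 c2) s (t1 + t2) Q.
Proof.
move=> [u1 [s1 [e1 le1 [u2 [s2 [e2 le2 q]]]]]].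
exists (u1 + u2), s2; split=> //; last exact: leq_add.
exact: ExecSeq e1 e2.
Qed.

Lemma runs_seq_framed c1 c2 s t1 t2 Q1 Q : keeps_reals c1 ->
  runs c1 s t1 Q1 ->
  (forall s1, framed c1 s s1 -> Q1 s1 -> runs c2 s1 t2 Q) ->
  runs (CSeq c1 c2) s (t1 + t2) Q.
Proof.
move=> k1 r1 r2; apply: runs_seq.
by apply: runs_weaken (runs_framed k1 r1) _ _ => // s1 [f q]; apply: r2.
Qed.

Lemma runs_if b c1 c2 s t Q :
  (beval s b -> runs c1 s t Q) -> (~~ beval s b -> runs c2 s t Q) ->
  runs (CIf b c1 c2) s (bcost b + t).+1 Q.
Proof.
case: (boolP (beval s b)) => bb h1 h2.
  have [u1 [s1 [e1 le1 q]]] := h1 isT; exists (bcost b + u1).+1, s1.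
  by split=> //; [exact: ExecIfTrue | rewrite ltnS leq_add2l].
have [u1 [s1 [e1 le1 q]]] := h2 isT; exists (bcost b + u1).+1, s1.
by split=> //; [exact: ExecIfFalse | rewrite ltnS leq_add2l].
Qed.

Lemma runs_wp c s Q : wp c Q s -> runs c s (straight_cost c) Q.
Proof.
elim: c s Q => //=.
- by move=> s Q q; exists 1, s; split=> //; constructor.
- move=> x e s Q [le q]; exists (icost e).+1, (set_ireg s x (ieval s e)).
  by split=> //; constructor.
- move=> x e s Q q; exists (rcost e).+1, (set_rreg s x (reval s e)).
  by split=> //; constructor.
- move=> a k e s Q [le q].
  exists (icost k + icost e).+1, (set_iarr s a (ieval s k) (ieval s e)).
  by split=> //; constructor.
- move=> a k e s Q q.
  exists (icost k + rcost e).+1, (set_rarr s a (ieval s k) (reval s e)).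
  by split=> //; constructor.
- move=> c1 IH1 c2 IH2 s Q h; apply: runs_seq.
  by apply: runs_weaken (IH1 _ _ h) _ _ => // s1; apply: IH2.
- move=> b c1 IH1 c2 IH2 s Q [h1 h2]; apply: runs_if => hb.
    by apply: runs_weaken (IH1 _ _ (h1 hb)) _ _ => //; apply: leq_maxl.
  by apply: runs_weaken (IH2 _ _ (h2 hb)) _ _ => //; apply: leq_maxr.
Qed.

Lemma runs_while (I : nat -> state R -> Prop) b c K Q m s0 : keeps_reals c ->
  (forall m s, framed c s0 s -> I m s -> ~~ beval s b -> Q s) ->
  (forall m s, framed c s0 s -> I m s -> beval s b ->
     0 < m /\ runs c s K (I m.-1)) ->
  I m s0 -> runs (CWhile b c) s0 (m.+1 * (bcost b + K).+1) Q.
Proof.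
move=> kc hQ hS.
suff run s : framed c s0 s -> I m s ->
    runs (CWhile b c) s (m.+1 * (bcost b + K).+1) Q by exact/run/frame_refl.
elim: m s => [|m IH] s fs Is; case: (boolP (beval s b)) => bb.
- by have [] := hS _ _ fs Is bb.
- exists (bcost b).+1, s; split;
    [exact: ExecWhileFalse|by rewrite mul1n ltnS leq_addr|].
  exact: hQ Is bb.
- have [_ /(runs_framed kc)[t1 [s1 [e1 le1 [f1 I1]]]]] := hS _ _ fs Is bb.
  have [t2 [s2 [e2 le2 q2]]] := IH s1 (frame_trans fs f1) I1.
  exists (bcost b + t1 + t2).+1, s2; split=> //; first exact: ExecWhileTrue e2.
  rewrite mulSn addSn ltnS; apply: leq_add => //.
  by rewrite leq_add2l.
- exists (bcost b).+1, s; split; [exact: ExecWhileFalse| |exact: hQ Is bb].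
  by rewrite mulSn addSn ltnS -addnA leq_addr.
Qed.

Definition ilt e1 e2 := BNot (ILe e2 e1).

Definition cfor k e c :=
  CSeq (CIReg k (IConst 0))
    (CWhile (ilt (IReg k) e) (CSeq c (CIReg k (IAdd (IReg k) (IConst 1))))).

Lemma runs_for (I : nat -> state R -> Prop) (k : nat) e c N K Q s0 :
  keeps_reals c -> k \notin regs_written c -> N <= w ->
  (forall j s, framed (cfor k e c) s0 s -> I j s -> ieval s e = N) ->
  I 0 (set_ireg s0 k 0) ->
  (forall j s, j < N -> framed (cfor k e c) s0 s -> ireg s k = j -> I j s ->
     runs c s K (fun s' => I j.+1 (set_ireg s' k j.+1))) ->
  (forall s, framed (cfor k e c) s0 s -> I N s -> Q s) ->
  runs (cfor k e c) s0 (2 + N.+1 * (4 + icost e + (K + 4)).+1) Q.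
Proof.
move=> kc nk Nw he h0 hS hQ.
have sub (s : state R) :
  framed (CSeq c (CIReg k (IAdd (IReg k) (IConst 1)))) (set_ireg s0 k 0) s ->
    framed (cfor k e c) s0 s.
  move=> f; apply: (@frame_trans _ _ _ (set_ireg s0 k 0)).
    by split=> //= y; rewrite inE /upd negb_or => /andP[/negPf ->].
  by apply: frame_sub f => // x xi; rewrite /= inE xi orbT.
apply: runs_seq.
apply: runs_weaken (runs_wp (c := CIReg k (IConst 0)) (conj _ _)) _ (fun _ p =>
  p) => //=.
pose J m s := [/\ m + ireg s k = N & I (ireg s k) s].
apply: runs_weaken (_ :
  runs _ _ (N.+1 * (bcost (ilt (IReg k) e) + (K + 4)).+1) Q) _ _ => //.
  apply: (@runs_while J); rewrite /= ?kc //=; last first.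
  - by split; rewrite /= /upd eqxx ?addn0.
  - move=> m s /sub f [mk Ik]; rewrite (he _ _ f Ik) -ltnNge => lt; split.
      by move: lt mk; lia.
    have r := hS _ _ lt f erefl Ik.
    apply: runs_seq_framed r _ => // s1 [_ f1 _ I1].
    have k1 := f1 _ nk.
    apply: runs_wp; rewrite /= k1 addn1; split; first by lia.
    by split; rewrite /= /upd eqxx //; lia.
  - move=> m s /sub f [mk Ik]; rewrite (he _ _ f Ik) negbK => le.
    apply: hQ f _; suff -> : N = ireg s k by []. by apply/eqP; rewrite eqn_leq; lia.
by rewrite leq_mul2l /=; lia.
Qed.

End Hoare.

(** * Strict weak orders *)

Section StrictWeak.
Variable T : Type.
Implicit Types r : rel T.

Definition strict_weak r :=
  (forall a b, r a b -> ~~ r b a) /\ (forall a b c, r a b -> r a c || r c b).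

Lemma sw_irr r a : strict_weak r -> r a a = false.
Proof. by case=> asym _; apply/negP => h; move: (asym _ _ h); rewrite h. Qed.

Lemma sw_trans r a b c : strict_weak r -> r a b -> r b c -> r a c.
Proof.
move=> [asym neg] ab bc; have /orP[//|cb] := neg _ _ c ab.
by move: (asym _ _ bc); rewrite cb.
Qed.

Lemma sw_ntrans r a b c : strict_weak r -> ~~ r a b -> ~~ r b c -> ~~ r a c.
Proof. by move=> [_ neg] nab nbc; apply/negP => /(neg _ _ b);
  rewrite (negPf nab) (negPf nbc). Qed.

Lemma sw_nlt_lt r a b c : strict_weak r -> ~~ r b a -> r b c -> r a c.
Proof. by move=> [_ neg] nba /(neg _ _ a); rewrite (negPf nba). Qed.

Definition lex r1 r2 : rel T := fun a b => r1 a b || (~~ r1 b a && r2 a b).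

Lemma sw_lex r1 r2 : strict_weak r1 -> strict_weak r2 -> strict_weak (lex r1 r2).
Proof.
move=> [as1 ne1] [as2 ne2]; split=> [a b|a b c]; rewrite /lex.
  case/orP=> [h|/andP[h1 h2]]; first by rewrite negb_or as1 // h.
  by rewrite negb_or h1 negb_and (as2 _ _ h2) orbT.
have := ne1 a b c; have := ne1 b a c; have := ne1 a c b; have := ne1 c b a.
have := as1 a b; have := as1 b a; have := as1 a c; have := as1 c a.
have := as1 c b; have := as1 b c; have := ne2 a b c.
have := ne1 b c a; have := ne1 c a b.
case: (r1 a b); case: (r1 b a); case: (r1 a c); case: (r1 c a);
case: (r1 b c); case: (r1 c b); case: (r2 a b) => //=;
by intuition.
Qed.

Definition rev_rel r : rel T := fun a b => r b a.

Lemma sw_rev r : strict_weak r -> strict_weak (rev_rel r).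
Proof. by move=> [as1 ne1]; split=> [a b /as1|a b c /(ne1 _ _ c)] //;
  rewrite orbC. Qed.

End StrictWeak.

Lemma sw_key (T : Type) d (O : orderType d) (f : T -> O) :
  strict_weak (fun a b => (f a < f b)%O).
Proof.
split=> [a b|a b c]; first by rewrite -leNgt => /ltW.
by case: (ltP (f a) (f c)) => //= ca /(le_lt_trans ca).
Qed.

(** * Sorting with a tournament tree *)

Section WinnerTree.
Local Open Scope nat_scope.
Variables (n : nat) (r : rel nat).
Hypothesis sw : strict_weak r.

(* [n] is an absent competitor, which loses against everybody. *)
Definition beats a b := (a < n) && ((n <= b) || r a b).

Lemma beats_sw : strict_weak beats.
Proof.
have [asym neg] := sw; split=> [a b|a b c]; rewrite /beats.
  move=> /andP[an ab]; apply/negP => /andP[bn].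
  by move: ab; rewrite leqNgt bn leqNgt an /= => /asym /negPf ->.
move=> /andP[an ab]; rewrite an /=; case: (leqP n c) => //= cn.
by move: ab; case: (leqP n b) => [|bn /= /neg]; [rewrite orbT|apply].
Qed.

Definition winner a b := if beats b a then b else a.

Definition decided (f : nat -> nat) u := f u = winner (f (u + u)) (f (u + u + 1)).

Lemma root_unbeaten f : (forall u, 0 < u < n -> decided f u) ->
  forall u, 0 < u < n + n -> ~~ beats (f u) (f 1).
Proof.
move=> ok; elim/ltn_ind => u IH ul.
have [->|u1] := eqVneq u 1; first by rewrite sw_irr //; exact: beats_sw.
have hb : 0 < u./2 < n by lia.
apply: (sw_ntrans (b := f u./2)); first exact: beats_sw; last by apply: IH; lia.
rewrite (ok _ hb) /winner.
have : u = u./2 + u./2 \/ u = u./2 + u./2 + 1 by lia.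
set a := f (u./2 + u./2); set b := f (u./2 + u./2 + 1).
case=> [|] -> ; rewrite -/a -/b; case: ifP => // h; rewrite ?h //.
- by have [asym _] := beats_sw; apply: asym.
- by rewrite sw_irr //; exact: beats_sw.
- by rewrite sw_irr //; exact: beats_sw.
Qed.

Lemma root_leaf f : (forall u, 0 < u < n -> decided f u) ->
  forall v, 0 < v < n + n -> exists2 u, n <= u < n + n & f u = f v.
Proof.
move=> ok v; move: {2}(n + n - v) (leqnn (n + n - v)) => m.
elim: m v => [|m IH] v vm vl; first by lia.
have [nv|vn] := leqP n v; first by exists v => //; lia.
have vb : 0 < v < n by lia.
rewrite (ok _ vb) /winner; case: ifP => _; apply: IH; lia.
Qed.

End WinnerTree.

Definition bor b1 b2 := BNot (BAnd (BNot b1) (BNot b2)).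

(* Arrays outside of [E] and the input are all that [cmp] may depend on. *)
Definition means (R : realType) (E : seq nat) (s0 : state R)
    (cmp : nat -> nat -> bexp) (r : rel nat) :=
  forall s, rarr s = rarr s0 -> (forall a, a \notin E -> iarr s a = iarr s0 a) ->
  forall x y, beval s (cmp x y) = r (ireg s x) (ireg s y).

Lemma means_frame (R : realType) D E' E (s0 s1 : state R) cmp r :
  {subset E' <= E} -> frame D E' s0 s1 -> means E s0 cmp r -> means E s1 cmp r.
Proof.
move=> EE [r1 _ a1] h s rs as_; apply: h; first by rewrite rs.
by move=> a aE; rewrite as_ ?a1 //; apply: contra aE; apply: EE.
Qed.

(* Integer registers: 0 number of items, 1 and 2 items being compared, 3 loop
   counter, 4 tree node, 5 number of piles, 6 to 8 binary search, 9 residue.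
   Integer arrays: 0 output, 1 tree, 2 sorted items, 3 pile tops, 4 predecessors,
   5 to 7 class, strip and residue on the x-axis, 8 to 10 on the y-axis, 11 junk.
   The leaves of the tree are the nodes [n], ..., [n + n - 1] and the children of
   the node [u] are [u + u] and [u + u + 1]. *)
Section Sort.
Local Open Scope nat_scope.
Variable cmp : nat -> nat -> bexp.

Definition beats_exp a b :=
  BAnd (ilt (IReg a) (IReg 0)) (bor (ILe (IReg 0) (IReg b)) (cmp a b)).

Definition climb_step :=
  CSeq (CIReg 4 (IHalf (IReg 4)))
 (CSeq (CIReg 1 (IGet 1 (IAdd (IReg 4) (IReg 4))))
 (CSeq (CIReg 2 (IGet 1 (IAdd (IAdd (IReg 4) (IReg 4)) (IConst 1))))
       (CIf (beats_exp 2 1) (CISet 1 (IReg 4) (IReg 2))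
                            (CISet 1 (IReg 4) (IReg 1))))).

Definition climb := CWhile (ILe (IConst 2) (IReg 4)) climb_step.

Definition sort_init := cfor 3 (IAdd (IReg 0) (IReg 0)) (CISet 1 (IReg 3) (IReg 0)).

Definition sort_insert_start :=
  CSeq (CIReg 4 (IAdd (IReg 0) (IReg 3))) (CISet 1 (IReg 4) (IReg 3)).

Definition sort_extract_start :=
  CSeq (CISet 2 (IReg 3) (IGet 1 (IConst 1)))
 (CSeq (CIReg 4 (IAdd (IReg 0) (IGet 1 (IConst 1))))
       (CISet 1 (IReg 4) (IReg 0))).

Definition sort_insert := cfor 3 (IReg 0) (CSeq sort_insert_start climb).
Definition sort_extract := cfor 3 (IReg 0) (CSeq sort_extract_start climb).
Definition tree_sort := CSeq sort_init (CSeq sort_insert sort_extract).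

Variables (R : realType) (w n : nat) (r : rel nat).
Hypothesis sw : strict_weak r.
Hypothesis tot : forall a b, a != b -> r a b || r b a.
Hypothesis nw : n + n + 2 <= w.

Local Notation decided := (decided n r).

Lemma beval_beats (s s' : state R) x y : means [:: 1; 2] s cmp r ->
  ireg s' 0 = n -> rarr s' = rarr s ->
  (forall a, a \notin [:: 1; 2] -> iarr s' a = iarr s a) ->
  beval s' (beats_exp x y) = beats n r (ireg s' x) (ireg s' y).
Proof.
move=> h n0 rs as_; rewrite /beats_exp /= h //.
by rewrite /beats n0 -ltnNge negb_and !negbK.
Qed.

Definition climb_cost m := m.+1 * (3 + straight_cost climb_step).+1.

Lemma runs_climb m (s : state R) : ireg s 0 = n -> means [:: 1; 2] s cmp r ->
  ireg s 4 < 2 ^ m -> ireg s 4 < n + n ->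
  (forall u, u < n + n -> iarr s 1 u <= n) ->
  (forall u, 0 < u < n -> u != (ireg s 4)./2 -> decided (iarr s 1) u) ->
  runs w climb s (climb_cost m) (fun s' =>
    [/\ forall u, u < n + n -> iarr s' 1 u <= n,
        forall u, 0 < u < n -> decided (iarr s' 1) u
      & forall u, n <= u -> iarr s' 1 u = iarr s 1 u]).
Proof.
move=> s0n hcmp Pm Pn bd ok.
pose J m (s' : state R) := [/\ ireg s' 4 < 2 ^ m, ireg s' 4 < n + n,
  (forall u, u < n + n -> iarr s' 1 u <= n),
  (forall u, 0 < u < n -> u != (ireg s' 4)./2 -> decided (iarr s' 1) u) &
  forall u, n <= u -> iarr s' 1 u = iarr s 1 u].
apply: (@runs_while _ _ J) => //=.
- move=> k s1 _ [_ _ bd1 ok1 lf1] P1; split=> // u un; apply: ok1 => //.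
  by apply/eqP; lia.
- move=> k s1 [rr fr fa] [Pk Pn1 bd1 ok1 lf1] P2; split.
    by case: k Pk => //; rewrite expn0; lia.
  have n1 : ireg s1 0 = n by rewrite fr.
  have bE (s2 : state R) : rarr s2 = rarr s1 -> iarr s2 = iarr s1 -> ireg s2 0 = n ->
      beval s2 (beats_exp 2 1) = beats n r (ireg s2 2) (ireg s2 1).
    move=> rr2 fa2 n2; apply: (beval_beats (s := s)) => //; first by rewrite rr2.
    by move=> a ha; rewrite fa2 fa //; move: ha; rewrite !inE; case: eqP.
  apply: runs_wp; rewrite /climb_step.
  move: (beats_exp 2 1) bE => be bE; rewrite /= /upd /= -/(upd _ _).
  set P := (ireg s1 4)./2; set f := iarr s1 1.
  have Pb : 0 < P < n by rewrite /P; lia.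
  have b1 : f (P + P) <= n by apply: bd1; lia.
  have b2 : f (P + P + 1) <= n by apply: bd1; lia.
  have Pk' : P < 2 ^ k.-1 by case: k Pk => [|k] /=; rewrite ?expn0 ?expnS /P => Pk;
    lia.
  split; first by lia.
  split; first by lia.
  split; first by lia.
  rewrite !bE //= /upd /=.
  have step v : v <= n -> v = winner n r (f (P + P)) (f (P + P + 1)) ->
      J k.-1 (set_iarr (set_ireg (set_ireg (set_ireg s1 4 P) 1 (f (P + P))) 2
        (f (P + P + 1))) 1 P v).
    move=> vn vw; split; rewrite /= /upd2 /upd /= -/f; first exact: Pk'.
    - by lia.
    - by move=> u un; case: eqP => // _; apply: bd1.
    - move=> u un uP; rewrite /decided.
      have [->|nuP] := eqVneq u P.
        by rewrite ifN ?ifN -?vw //; apply/eqP; lia.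
      have e1 : u + u != P by apply/eqP; lia.
      have e2 : u + u + 1 != P by apply/eqP; lia.
      by rewrite (negPf e1) (negPf e2); apply: ok1.
    - by move=> u un; rewrite ifN; [exact: lf1 | apply/eqP; lia].
  split=> h; split; rewrite ?b1 ?b2 //; try lia; apply: step => //.
    by rewrite /winner h.
  by rewrite /winner ifN.
Qed.

Definition init_cost :=
  2 + (n + n).+1 * (7 + (straight_cost (CISet 1 (IReg 3) (IReg 0)) + 4)).+1.

Lemma runs_sort_init (s : state R) : ireg s 0 = n ->
  runs w sort_init s init_cost (fun s' => forall u, u < n + n -> iarr s' 1 u = n).
Proof.
move=> s0n.
apply: (@runs_for _ _ (fun j s' => forall u, u < j ->
  iarr s' 1 u = n) 3 _ _ (n + n)) => //.
- by lia.
- by move=> j s1 [_ fr _] _; rewrite /= fr // s0n.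
- move=> j s1 jn [_ fr _] kj Ij; apply: runs_wp => /=.
  rewrite fr // s0n; split; first by lia.
  move=> u uj; rewrite /upd2 /upd /= kj; case: eqP => // ne.
  by apply: Ij; lia.
Qed.

Definition insert_cost m :=
  2 + n.+1 * (5 + (straight_cost sort_insert_start + climb_cost m + 4)).+1.

Lemma runs_sort_insert m (s : state R) : ireg s 0 = n ->
  means [:: 1; 2] s cmp r -> n + n < 2 ^ m ->
  (forall u, u < n + n -> iarr s 1 u = n) ->
  runs w sort_insert s (insert_cost m) (fun s' =>
    [/\ forall u, u < n + n -> iarr s' 1 u <= n,
        forall u, 0 < u < n -> decided (iarr s' 1) u
      & forall u, u < n -> iarr s' 1 (n + u) = u]).
Proof.
move=> s0n hcmp nm s1n.
apply: (@runs_for _ _ (fun j s' =>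
    [/\ forall u, u < n + n -> iarr s' 1 u <= n,
        forall u, 0 < u < n -> decided (iarr s' 1) u
      & forall u, u < n -> iarr s' 1 (n + u) = if u < j then u else n])
  3 _ _ n) => //.
- by lia.
- by move=> j s1 [_ fr _] _; rewrite /= fr // s0n.
- split=> /= u un; rewrite ?s1n //; try lia.
  by rewrite /decided !s1n ?/winner ?if_same //; lia.
- move=> j s1 jn f1 kj [bd ok lf].
  have n1 : ireg s1 0 = n by case: f1 => _ -> .
  apply: runs_seq; apply: runs_weaken (runs_wp (_ : wp w _ _ _)) (leqnn _) _.
    rewrite /= /upd /= n1 kj; split; first by lia.
    split; first by lia.
    exact: erefl.
  move=> s2 <-.
  apply: runs_weaken (runs_climb (m := m) _ _ _ _ _ _) (leqnn _) _ => //=.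
  - apply: means_frame _ (_ : frame [:: 3; 4; 1; 2] [:: 1; 2] s _) hcmp => //.
    apply: (@frame_trans _ _ _ _ s1).
      by apply: frame_sub f1 => x; rewrite /= !inE; do ?case: eqP.
    split=> //= a; rewrite /upd2 /upd !inE; first by move=> /norP[_ /norP[/negPf ->]].
    by move=> /norP[/negPf -> _].
  - by rewrite /upd /=; lia.
  - by rewrite /upd /=; lia.
  - by move=> u un; rewrite /upd2 /upd /=; case: eqP => _; [lia|apply: bd].
  - move=> u un; rewrite /upd2 /upd /= => uP; rewrite /decided !ifN.
    + exact: ok.
    + by apply/eqP; lia.
    + by apply/eqP; lia.
    + by apply/eqP; lia.
  - move=> s3; rewrite /= /upd2 /upd /= => -[bd3 ok3 lf3]; split=> // u un.
    rewrite lf3 ?leq_addr // eqn_add2l; case: eqP => [->|ne].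
      by rewrite ltnSn.
    by rewrite lf //; have -> : (u < j.+1) = (u < j) by apply/idP/idP; lia.
- by move=> s1 _ [bd ok lf]; split=> // u un; rewrite lf // un.
Qed.

Definition extract_cost m :=
  2 + n.+1 * (5 + (straight_cost sort_extract_start + climb_cost m + 4)).+1.

Lemma runs_sort_extract m (s : state R) : ireg s 0 = n ->
  means [:: 1; 2] s cmp r -> n + n < 2 ^ m ->
  (forall u, u < n + n -> iarr s 1 u <= n) ->
  (forall u, 0 < u < n -> decided (iarr s 1) u) ->
  (forall u, u < n -> iarr s 1 (n + u) = u) ->
  runs w sort_extract s (extract_cost m) (fun s' =>
    (forall j, j < n -> iarr s' 2 j < n) /\
    (forall i j, i < j < n -> r (iarr s' 2 i) (iarr s' 2 j))).
Proof.
move=> s0n hcmp nm bds oks lfs.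
pose out (s' : state R) (j : nat) := [seq iarr s' 2 i | i <- iota 0 j] : seq nat.
pose I j (s' : state R) := [/\ (forall u, u < n + n -> iarr s' 1 u <= n) /\
        (forall u, 0 < u < n -> decided (iarr s' 1) u),
        forall u, u < n -> iarr s' 1 (n + u) = if u \in out s' j then n else u,
        forall i, i < j -> iarr s' 2 i < n,
        forall i i', i < i' < j -> r (iarr s' 2 i) (iarr s' 2 i')
      & forall i u, i < j -> u < n -> u \notin out s' j -> r (iarr s' 2 i) u].
apply: (@runs_for _ _ I 3 _ _ n) => //.
- by lia.
- by move=> j s1 [_ fr _] _; rewrite /= fr // s0n.
- by split=> // i i'; rewrite ltn0 andbF.
- move=> j s1 jn f1 kj [[bd ok] lf An Ar Au].
  have n1 : ireg s1 0 = n by case: f1 => _ -> .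
  pose e := iarr s1 1 1.
  have min_e v : v < n -> v \notin out s1 j -> ~~ beats n r v e.
    move=> vn vo; have := root_unbeaten (u := n + v) sw ok.
    by rewrite lf // (negPf vo); apply; lia.
  have [v0 v0n v0o] : exists2 v, v < n & v \notin out s1 j.
    have [/hasP[v]|/hasPn h] := boolP (has (fun v => v \notin out s1 j) (iota 0 n)).
      by rewrite mem_iota => vn; exists v.
    have := @uniq_leq_size _ (iota 0 n) (out s1 j) (iota_uniq 0 n).
    rewrite size_map !size_iota leqNgt jn => H.
    by have /H : {subset iota 0 n <= out s1 j} by move=> v /h; rewrite negbK.
  have en : e < n.
    by rewrite ltnNge; apply: contra (min_e _ v0n v0o) => ne; rewrite /beats v0n ne.
  have eo : e \notin out s1 j.
    have [|u ul fu] := root_leaf ok (v := 1); first by lia.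
    move: fu; have -> : u = n + (u - n) by lia.
    rewrite lf; last by lia.
    by case: ifP => [_|/negbT uo]; rewrite -/e => ue; [lia|rewrite -ue].
  have min_r v : v < n -> v \notin out s1 j -> v != e -> r e v.
    move=> vn vo ne; have := min_e v vn vo; rewrite /beats vn leqNgt en /= => nr.
    by have := tot ne; rewrite (negPf nr).
  apply: runs_seq; apply: runs_weaken (runs_wp (_ : wp w _ _ _)) (leqnn _) _.
    rewrite /= /upd2 /upd /= n1 kj -/e; split; first by lia.
    split; first by lia.
    split; first by lia.
    exact: erefl.
  move=> s2 <-.
  apply: runs_weaken (runs_framed _ (runs_climb (m :=
    m) _ _ _ _ _ _)) (leqnn _) _ => //=.
  - apply: means_frame _ (_ : frame [:: 3; 4; 1; 2] [:: 1; 2] s _) hcmp => //.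
    apply: (@frame_trans _ _ _ _ s1).
      by apply: frame_sub f1 => x; rewrite /= !inE; do ?case: eqP.
    split=> //= a; rewrite /upd2 /upd !inE; first by move=> /norP[_ /norP[/negPf ->]].
    by move=> /norP[/negPf -> /negPf ->].
  - by rewrite /upd /=; lia.
  - by rewrite /upd /=; lia.
  - by move=> u un; rewrite /upd2 /upd /=; case: eqP => _; [lia|apply: bd].
  - move=> u un; rewrite /upd2 /upd /= => uP; rewrite /decided !ifN.
    + exact: ok.
    + by apply/eqP; lia.
    + by apply/eqP; lia.
    + by apply/eqP; lia.
  - move=> s3 [[_ _ fa3] []]; have := fa3 2 isT; rewrite /= /upd2 /upd /= =>
      A3 bd3 ok3 lf3.
    have Ai i : i < j -> iarr s3 2 i = iarr s1 2 i.
      by move=> ij; rewrite A3 ifN //; apply/eqP; lia.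
    have Aj : iarr s3 2 j = e by rewrite A3 eqxx.
    have oS : out s3 j.+1 =i rcons (out s1 j) e.
      move=> x; rewrite /out -[j.+1]addn1 iotaD map_cat /= add0n Aj cats1.
      congr (_ \in rcons _ _); apply/eq_in_map => i.
      by rewrite mem_iota add0n => /Ai.
    have eqout x : (x \in out (set_ireg s3 3 j.+1) j.+1) = (x == e) || (x \in out s1 j).
      by rewrite -[LHS]/(x \in out s3 j.+1) oS mem_rcons inE.
    split=> //.
    + move=> u un; rewrite eqout /= lf3 ?leq_addr // eqn_add2l; case: eqP => //= _.
      exact: lf.
    + move=> i; rewrite ltnS leq_eqVlt => /orP[/eqP ->|ij] /=; first by rewrite Aj.
      by rewrite Ai ?An.
    + move=> i i' /= /andP[ii']; rewrite ltnS leq_eqVlt => /orP[/eqP e'|i'j].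
        by move: ii'; rewrite e' Aj => ij; rewrite Ai //; apply: Au.
      by rewrite !Ai ?Ar ?ii' //; lia.
    + move=> i u ij un; rewrite eqout negb_or => /andP[ue uo] /=.
      move: ij; rewrite ltnS leq_eqVlt => /orP[/eqP ->|ij].
        by rewrite Aj; apply: min_r.
      by rewrite Ai //; apply: Au.
- by move=> s1 _ [_ _ An Ar _]; split.
Qed.

End Sort.

Section SortCost.
Local Open Scope nat_scope.

Definition nlogn n := n.+1 * (trunc_log 2 n).+1.

Lemma nlogn_gt0 n : 0 < nlogn n.
Proof. by rewrite muln_gt0. Qed.

Lemma leq_nlogn c n : c <= c * nlogn n.
Proof. by rewrite leq_pmulr // nlogn_gt0. Qed.

Lemma leq_add_nlogn n a b C D :
  a <= C * nlogn n -> b <= D * nlogn n -> a + b <= (C + D) * nlogn n.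
Proof. by rewrite mulnDl; apply: leq_add. Qed.

Lemma leq_loop_nlogn n x D :
  x <= D * (trunc_log 2 n).+1 -> 2 + n.+1 * x <= (2 + D) * nlogn n.
Proof.
move=> le; apply: leq_add_nlogn; first exact: leq_nlogn.
by rewrite /nlogn mulnCA leq_mul2l le orbT.
Qed.

Definition enumerates (r : rel nat) n (A : nat -> nat) :=
  (forall j, j < n -> A j < n) /\ (forall i j, i < j < n -> r (A i) (A j)).

Lemma runs_sort cmp : exists C, forall (R : realType) w n (r : rel nat) (s : state R),
  strict_weak r -> (forall a b : nat, a != b -> r a b || r b a) -> n + n + 2 <= w ->
  ireg s 0 = n -> means [:: 1; 2] s cmp r ->
  runs w (tree_sort cmp) s (C * nlogn n) (fun s' => enumerates r n (iarr s' 2)).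
Proof.
pose c1 := straight_cost (CISet 1 (IReg 3) (IReg 0)).
pose c2 := straight_cost sort_insert_start.
pose c3 := straight_cost sort_extract_start.
pose c4 := straight_cost (climb_step cmp).
pose loop c := 2 + ((c + 9).+1 + 3 * (3 + c4).+1).
exists (2 + 2 * (c1 + 12) + (loop c2 + loop c3)) => R w n r s sw tot nw s0n hcmp.
set g := (trunc_log 2 n).
have nm : n + n < 2 ^ g.+2.
  by rewrite expnS mul2n -addnn; have := trunc_log_ltn n (ltnSn 1); rewrite -/g; lia.
have loopE c : 2 + n.+1 * (5 + (c + climb_cost cmp g.+2 + 4)).+1 <= loop c * nlogn n.
  apply: leq_loop_nlogn; rewrite /climb_cost -/c4 -/g.
  have : (c + 9).+1 <= (c + 9).+1 * g.+1 by rewrite leq_pmulr.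
  have : g.+3 * (3 + c4).+1 <= 3 * (3 + c4).+1 * g.+1.
    by rewrite mulnAC leq_mul2r; lia.
  rewrite mulnDl; lia.
apply: (@runs_weaken _ _ _ _ (init_cost n +
    (insert_cost cmp n g.+2 + extract_cost cmp n g.+2)) _ (fun s' =>
      enumerates r n (iarr s' 2))) => //.
  rewrite /tree_sort; apply: (runs_seq_framed _ (runs_sort_init nw s0n)) => //
    s1 f1 T1.
  have n1 : ireg s1 0 = n by case: f1 => _ -> .
  have m1 : means [:: 1; 2] s1 cmp r.
    by apply: means_frame f1 hcmp => x; rewrite !inE => ->.
  apply: (runs_seq_framed _ (runs_sort_insert nw n1 m1 nm T1)) => // s2 f2 [bd ok lf].
  apply: runs_sort_extract => //; first by case: f2 => _ -> .
  by apply: means_frame f2 m1 => x; rewrite /= !inE; do ?case: eqP.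
rewrite mulnDl; apply: leq_add; last by apply: leq_add_nlogn; apply: loopE.
rewrite /init_cost -/c1 mulnDl; apply: leq_add; first exact: leq_nlogn.
have h : (n + n).+1 <= 2 * nlogn n.
  have : n.+1 <= nlogn n by rewrite leq_pmulr.
  by lia.
apply: leq_trans (leq_mul h (leqnn _)) _.
by rewrite mulnAC leq_mul2r; apply/orP; right; lia.
Qed.

End SortCost.

(** * Greedy splitting of a sorted enumeration *)

Section Scan.
Local Open Scope nat_scope.

Definition next3 c := if 2 <= c then 0 else c + 1.

(* The current head and a counter modulo 3 after reading [k] items of the
   enumeration [A]; an item [i] with [fresh h i] replaces the head [h]. *)
Fixpoint scan (fresh : rel nat) (A : nat -> nat) k : nat * nat :=
  if k is k'.+1 then
    let hc := scan fresh A k' in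
    if fresh hc.1 (A k') then (A k', next3 hc.2) else hc
  else (A 0, 0).

Lemma scan_head fresh A k : exists2 j, j <= k.-1 & (scan fresh A k).1 = A j.
Proof.
elim: k => [|k [j jk hj]] /=; first by exists 0.
case: ifP => _; [exists k|exists j]; rewrite //; lia.
Qed.

Lemma scan_counter fresh A k : (scan fresh A k).2 < 3.
Proof.
elim: k => //= k IH; case: ifP => _ //=.
by rewrite /next3; case: ifP => //; lia.
Qed.

Variables (fresh_exp : nat -> nat -> bexp) (H G : nat).

Definition scan_body :=
  CSeq (CIReg 2 (IGet 2 (IReg 3)))
 (CSeq (CIf (fresh_exp 1 2)
         (CSeq (CIReg 1 (IReg 2))
               (CIf (ILe (IConst 2) (IReg 9)) (CIReg 9 (IConst 0))
                    (CIReg 9 (IAdd (IReg 9) (IConst 1)))))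
         CSkip)
 (CSeq (CISet H (IReg 2) (IReg 1)) (CISet G (IReg 2) (IReg 9)))).

Definition scan_start := CSeq (CIReg 9 (IConst 0)) (CIReg 1 (IGet 2 (IConst 0))).

Definition scan_com := CSeq scan_start (cfor 3 (IReg 0) scan_body).

Lemma runs_scan : exists C, forall (R : realType) w n (fresh : rel nat) A (s :
  state R),
  H != 2 -> G != 2 -> H != G ->
  n + n + 2 <= w -> ireg s 0 = n -> 0 < n ->
  iarr s 2 = A -> (forall j, j < n -> A j < n) ->
  (forall i j, i < j < n -> A i != A j) ->
  means [:: H; G] s fresh_exp fresh ->
  runs w scan_com s (C * nlogn n) (fun s' => forall k, k < n ->
    iarr s' H (A k) = (scan fresh A k.+1).1 /\
    iarr s' G (A k) = (scan fresh A k.+1).2).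
Proof.
exists (straight_cost scan_start + (2 + (9 + straight_cost scan_body).+1)).
move=> R w n fresh A s H2 G2 HG nw s0n n0 sA An Ai hfresh.
apply: (@runs_weaken _ _ _ _ (straight_cost scan_start + (2 + n.+1 * (4 + 1 + (straight_cost scan_body + 4)).+1)) _
  (fun s' => forall k, k < n ->
    iarr s' H (A k) = (scan fresh A k.+1).1 /\
    iarr s' G (A k) = (scan fresh A k.+1).2)) => //; last first.
  apply: leq_add_nlogn; first exact: leq_nlogn.
  by apply: leq_loop_nlogn; apply: leq_trans (leq_pmulr _ _) => //; lia.
apply: runs_seq; apply: runs_weaken (runs_wp (_ : wp w _ _ _)) (leqnn _) _.
  rewrite /= sA; split; first by lia.
  split; first by have := An 0 n0; lia.
  exact: erefl.
move=> s1 <-.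
pose I j (s' : state R) := [/\ ireg s' 1 = (scan fresh A j).1,
  ireg s' 9 = (scan fresh A j).2
  & forall k, k < j -> iarr s' H (A k) = (scan fresh A k.+1).1 /\
    iarr s' G (A k) = (scan fresh A k.+1).2].
have hn j : j <= n -> (scan fresh A j).1 < n.
  by move=> jn; have [i ij ->] := scan_head fresh A j; apply: An; lia.
apply: (@runs_for _ _ I 3 _ _ n) => //.
- by lia.
- by move=> j s2 [_ fr _] _; rewrite /= fr // s0n.
- move=> j s2 jn [rr fr fa] kj [h1 h9 hk].
  have a2 : iarr s2 2 = A.
    by rewrite fa //= !inE negb_or eq_sym H2 eq_sym.
  have E (s3 : state R) : rarr s3 = rarr s2 -> iarr s3 = iarr s2 ->
      beval s3 (fresh_exp 1 2) = fresh (ireg s3 1) (ireg s3 2).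
    move=> r3 a3; apply: hfresh; first by rewrite r3 rr.
    by move=> a; rewrite a3 => aE; rewrite fa.
  apply: runs_wp; rewrite /scan_body; move: (fresh_exp 1 2) E => be E.
  rewrite /= a2 kj; split; first by have := An j jn; lia.
  have cn := scan_counter fresh A j.
  have done (s3 : state R) c : iarr s3 = iarr s2 -> ireg s3 2 = A j ->
      scan fresh A j.+1 = (ireg s3 1, ireg s3 9) ->
      I j.+1 (set_ireg (set_iarr (set_iarr s3 H (A j) (ireg s3 1)) G (A j) (ireg s3 9)) 3 c).
    move=> a3 r2 sc; split; rewrite ?sc //.
    move=> k kj1 /=;
      rewrite /upd2 /upd a3 [G == H]eq_sym (negPf HG) !eqxx -/(scan fresh A k.+1).
    have [->|nkj] := eqVneq k j; first by rewrite !eqxx sc.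
    have kj' : k < j by move/eqP: nkj; lia.
    by rewrite (negPf (Ai _ _ _)) ?kj' //; apply: hk.
  rewrite E //= /upd /= h1 h9; split=> fr1; last first.
    split; first by have := hn j; lia.
    split; first by lia.
    have := @done (set_ireg s2 2 (A j)) j.+1; rewrite /= /upd /= h1 h9; apply => //.
    by rewrite (negPf fr1); case: (scan _ _ _).
  split; first by have := An j jn; lia.
  split=> c2; (split; first by lia); (split; first by have := An j jn; lia);
    (split; first by lia).
    have := @done (set_ireg (set_ireg (set_ireg s2 2 (A j)) 1 (A j)) 9 0) j.+1.
    by rewrite /= /upd /=; apply => //; rewrite fr1 /next3 c2.
  have := @done (set_ireg (set_ireg (set_ireg s2 2 (A j)) 1 (A j)) 9 ((scan fresh A j).2 + 1)) j.+1.
  by rewrite /= /upd /=; apply => //; rewrite fr1 /next3 (negPf c2).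
- by move=> s2 _ [].
Qed.
End Scan.

Section ScanTheory.
Local Open Scope ring_scope.
Variable R : realType.

Lemma enumerates_neq r n A i j : strict_weak r -> enumerates r n A ->
  (i < j < n)%N -> A i != A j.
Proof.
move=> sw [_ Ar] ij; apply/eqP => e.
by have := Ar _ _ ij; rewrite e sw_irr.
Qed.

Lemma enumerates_surj r n A : strict_weak r -> enumerates r n A ->
  forall i, (i < n)%N -> exists2 k, (k < n)%N & A k = i.
Proof.
move=> sw en i lt_i; have [An Ar] := en.
have inj : injective (fun k : 'I_n => Ordinal (An k (ltn_ord k))).
  move=> k l /(congr1 val) /= e; apply: val_inj => /=.
  case: (ltngtP k l) => // h.
    by have := @enumerates_neq _ _ _ k l sw en; rewrite h ltn_ord e eqxx => /(_ isT).
  by have := @enumerates_neq _ _ _ l k sw en; rewrite h ltn_ord e eqxx => /(_ isT).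
have /codomP[k ek] : Ordinal lt_i \in codom (fun k : 'I_n =>
  Ordinal (An k (ltn_ord k))).
  by apply: (inj_card_onto inj).
by exists k => //; have /(congr1 val) := ek.
Qed.

Lemma scan_doubling n A (len : nat -> R) :
  (forall i, (i < n)%N -> 0 < len i) -> (forall j, (j < n)%N -> (A j < n)%N) ->
  (forall i j, (i < j < n)%N -> len (A i) <= len (A j)) ->
  let fr a b := 4 * len a ^+ 2 <= len b ^+ 2 in
  let h k := (scan fr A k.+1).1 in
  (forall k, (k < n)%N -> [/\ (h k < n)%N, len (h k) <=
    len (A k) & len (A k) < 2 * len (h k)])
  /\ forall i j, (i <= j < n)%N -> h i = h j \/ 2 * len (h i) <= len (h j).
Proof.
move=> len0 An Ar fr.
have frE a b : (a < n)%N -> (b < n)%N -> fr a b = (2 * len a <= len b).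
  move=> an bn; rewrite /fr -[4]/(2 * 2)%:R natrM -expr2 -exprMn.
  by rewrite ler_pXn2r // nnegrE ?mulr_ge0 // ltW // len0.
move=> h.
have hp k : (k < n)%N -> ((scan fr A k).1 < n)%N /\ len (scan fr A k).1 <= len (A k).
  move=> kn; have [j jk ->] := scan_head fr A k; split; first by apply: An; lia.
  have [->//|jk'] := eqVneq j k; apply: Ar; move/eqP: jk'; lia.
split=> [k kn|i j].
  have [pn ple] := hp k kn; have pos := len0 _ (An k kn).
  rewrite /h /=; case: ifP => /= [_|]; first by split; [exact: An| |lra].
  by rewrite frE ?An // => /negbT; rewrite -ltNge.
elim: j => [|j IH] /andP[]; first by rewrite leqn0 => /eqP -> _; left.
rewrite leq_eqVlt => /orP[/eqP -> _|ij jn]; first by left.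
have jn' : (j < n)%N by lia.
have {}IH : h i = h j \/ 2 * len (h i) <= len (h j) by apply: IH; lia.
have [pn _] := hp _ jn.
rewrite {2 4}/h [scan _ _ j.+2]/=; case: ifP => /= [|_]; last exact: IH.
rewrite frE ?An // -/(h j) => le; right.
case: IH => [->//|le2]; have := len0 _ pn; rewrite -/(h j) => h0.
by move: le le2 h0; lra.
Qed.

Lemma scan_strips n A (c : nat -> nat) (x len : nat -> R) :
  (forall i, (i < n)%N -> (c i < n)%N /\ 0 < len (c i)) ->
  (forall j, (j < n)%N -> (A j < n)%N) ->
  (forall i j, (i < j < n)%N ->
     (c (A i) < c (A j))%N \/ c (A i) = c (A j) /\ x (A i) <= x (A j)) ->
  let fr a b := (c a != c b) || (len (c a) ^+ 2 <= (x b - x a) ^+ 2) in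
  let h k := (scan fr A k.+1).1 in
  let t k := (scan fr A k.+1).2 in
  (forall k, (k < n)%N -> [/\ (h k < n)%N, x (h k) <= x (A k)
                            & x (A k) < x (h k) + len (c (A k))])
  /\ forall i j, (i <= j < n)%N -> c (A i) = c (A j) -> t i = t j ->
       h i = h j \/ x (h i) + 3 * len (c (A i)) <= x (h j).
Proof.
move=> cn An Ar fr h t.
have hp k : (k < n)%N -> exists2 i, (i <= k)%N & (scan fr A k).1 = A i.
  by move=> kn; have [j jk ->] := scan_head fr A k; exists j => //; lia.
have sorted i k : (i <= k < n)%N ->
  (c (A i) < c (A k))%N \/ c (A i) = c (A k) /\ x (A i) <= x (A k).
  move=> /andP[ik kn]; have [->|/eqP ne] := eqVneq i k; first by right.
  by apply: Ar; lia.
have frE i k : (i <= k < n)%N -> c (A i) = c (A k) ->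
  fr (A i) (A k) = (x (A i) + len (c (A k)) <= x (A k)).
  move=> ik cik; have [|[_ le]] := sorted _ _ ik; first by rewrite cik ltnn.
  have kn : (k < n)%N by case/andP: ik.
  have [_ l0] := cn _ (An _ kn).
  rewrite /fr cik eqxx /= ler_pXn2r ?nnegrE ?subr_ge0 ?(ltW l0) //.
  by apply/idP/idP; lra.
have hc k : (k < n)%N -> [/\ (h k < n)%N, c (h k) = c (A k), x (h k) <= x (A k)
                            & x (A k) < x (h k) + len (c (A k))].
  move=> kn; have [i ik hi] := hp k kn; have [_ l0] := cn _ (An _ kn).
  rewrite /h /=; case: ifP => /= [_|].
    by split; rewrite ?An //; lra.
  rewrite hi => nf.
  have cik : c (A i) = c (A k) by move: nf; rewrite /fr; case: eqP.
  move: nf; rewrite frE ?ik //= => /negbT; rewrite -ltNge => nf.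
  have ikn : (i <= k < n)%N by rewrite ik.
  have [|[_ le]] := sorted i k ikn.
    by rewrite cik ltnn.
  by split=> //; apply: An; lia.
split=> [k kn|i j ij cij tij]; first by have [] := hc k kn.
suff [d [td hd xd]] : exists d, [/\ t j = iter d next3 (t i), d = 0%N -> h i = h j
    & x (h i) + d%:R * len (c (A i)) <= x (h j)].
  have [_ l0] := cn _ (An i ltac:(lia)).
  have ti := scan_counter fr A i.+1; rewrite -/(t i) in ti.
  case: d td hd xd => [|[|[|d]]] td hd xd; first by left; apply: hd.
  - by move: td ti; rewrite -tij /= /next3; case: ifP; lia.
  - by move: td ti; rewrite -tij /= /next3; do 2?case: ifP; lia.
  - right; apply: le_trans xd; rewrite lerD2l ler_wpM2r ?(ltW l0) //.
    by rewrite ler_nat.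
clear tij; elim: j ij cij => [|j IH] /andP[].
  by rewrite leqn0 => /eqP -> _ _; exists 0%N; split=> //; lra.
rewrite leq_eqVlt => /orP[/eqP -> _|ij jn] cij.
  by exists 0%N; split=> //; lra.
have cj : c (A i) = c (A j).
  have jj : (j <= j.+1 < n)%N by rewrite leqnSn.
  have [l1|[e1 _]] := sorted i j ltac:(lia); have [l2|[e2 _]] := sorted j j.+1 jj;
    lia.
have [|d [td hd xd]] := IH _ cj; first by lia.
have [hn ch xh1 xh2] := hc j ltac:(lia).
have [k kj hk] := hp _ jn.
have hS : h j.+1 = if fr (h j) (A j.+1) then A j.+1 else h j.
  by rewrite {1}/h [scan _ _ _]/= -/(h j); case: ifP.
have tS : t j.+1 = if fr (h j) (A j.+1) then next3 (t j) else t j.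
  by rewrite {1}/t [scan _ _ _]/= -/(h j); case: ifP.
rewrite hS tS; case: ifP => [f1|_]; last by exists d.
exists d.+1; split=> //; first by rewrite /= -td.
move: f1; rewrite /h hk frE ?kj //; last by rewrite -hk -/(h j) ch -cj cij.
rewrite -hk -/(h j) -cij => le; rewrite -[d.+1%:R]natr1 mulrDl mul1r.
by move: le xd; lra.
Qed.

End ScanTheory.

(** * Longest chains by patience sorting *)

Section LongestChain.
Local Open Scope nat_scope.
Variable val_exp : nat -> nat -> bexp.

Definition search_step :=
  CSeq (CIReg 8 (IHalf (IAdd (IReg 6) (IReg 7))))
 (CSeq (CIReg 1 (IGet 3 (IReg 8)))
       (CIf (val_exp 1 2) (CIReg 6 (IAdd (IReg 8) (IConst 1))) (CIReg 7 (IReg 8)))).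

Definition search := CWhile (ilt (IReg 6) (IReg 7)) search_step.

Definition search_start :=
  CSeq (CIReg 2 (IGet 2 (IReg 3))) (CSeq (CIReg 6 (IConst 0)) (CIReg 7 (IReg 5))).

Definition place :=
  CSeq (CISet 3 (IReg 6) (IReg 2))
 (CSeq (CISet 4 (IReg 2) (IGet 3 (ISub (IReg 6) (IConst 1))))
       (CIf (ILe (IReg 5) (IReg 6)) (CIReg 5 (IAdd (IReg 6) (IConst 1))) CSkip)).

Definition piles := cfor 3 (IReg 0) (CSeq search_start (CSeq search place)).

Definition trace_step :=
  CSeq (CISet 0 (IReg 1) (IConst 1))
 (CSeq (CIReg 1 (IGet 4 (IReg 1))) (CIReg 5 (ISub (IReg 5) (IConst 1)))).

Definition trace := CWhile (ILe (IConst 1) (IReg 5)) trace_step.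

Definition longest_chain :=
  CSeq (CIReg 5 (IConst 0))
 (CSeq piles
 (CSeq (CIReg 1 (IGet 3 (ISub (IReg 5) (IConst 1)))) trace)).

Variables (R : realType) (w n : nat) (V : rel nat) (A : nat -> nat).
Hypothesis sw : strict_weak V.
Hypothesis nw : n + n + 2 <= w.
Hypothesis An : forall j, j < n -> A j < n.
Hypothesis Ai : forall i j, i < j < n -> A i != A j.

Let A_neq i j : i < n -> j < n -> i != j -> A i != A j.
Proof.
move=> ni nj; case: (ltngtP i j) => // h _; first by rewrite Ai // h.
by rewrite eq_sym Ai // h.
Qed.

Definition search_cost k := k.+1 * (4 + straight_cost search_step).+1.

Lemma runs_search k (s : state R) : means [:: 0; 3; 4] s val_exp V ->
  ireg s 6 = 0 -> ireg s 7 = ireg s 5 -> ireg s 5 < 2 ^ k -> ireg s 5 <= n ->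
  (forall p, p < ireg s 5 -> iarr s 3 p < n) ->
  (forall p q, p < q < ireg s 5 -> V (iarr s 3 p) (iarr s 3 q)) ->
  runs w search s (search_cost k) (fun s' =>
    [/\ ireg s' 6 <= ireg s 5,
        forall p, p < ireg s' 6 -> V (iarr s 3 p) (ireg s 2)
      & forall p, ireg s' 6 <= p < ireg s 5 -> ~~ V (iarr s 3 p) (ireg s 2)]).
Proof.
move=> hV s6 s7 mk mn fn fV; set f := iarr s 3; set m := ireg s 5; set e := ireg s 2.
pose J k (s' : state R) := [/\ ireg s' 7 - ireg s' 6 < 2 ^ k, ireg s' 6 <=
  ireg s' 7 <= m,
        forall p, p < ireg s' 6 -> V (f p) e
      & forall p, ireg s' 7 <= p < m -> ~~ V (f p) e].
apply: (@runs_while _ _ J) => //=.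
- move=> k' s1 _ [_ b lo hi] le; have eq : ireg s1 7 = ireg s1 6 by lia.
  by split=> //; [lia|move=> p; rewrite -eq; apply: hi].
- move=> k' s1 [rr fr fa] [kk b lo hi]; rewrite -ltnNge => lt; split.
    by case: k' kk => //; rewrite expn0; lia.
  have E (s2 : state R) : rarr s2 = rarr s1 -> iarr s2 = iarr s1 ->
      beval s2 (val_exp 1 2) = V (ireg s2 1) (ireg s2 2).
    move=> r2 a2; apply: hV; first by rewrite r2 rr.
    by move=> a; rewrite a2 => aE; rewrite fa.
  have a3 : iarr s1 3 = f by rewrite fa.
  have r2 : ireg s1 2 = e by rewrite fr.
  apply: runs_wp; rewrite /search_step; move: (val_exp 1 2) E => be E.
  rewrite /= /upd /= a3; set mid := (_./2).
  have mb : ireg s1 6 <= mid < ireg s1 7 by rewrite /mid; lia.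
  have kk' : (ireg s1 7 - ireg s1 6)./2 < 2 ^ k'.-1.
    by case: k' kk => [|k''] /=; rewrite ?expn0 ?expnS => kk; lia.
  split; first by lia.
  split; first by have := fn mid; rewrite -/f; lia.
  rewrite E //= /upd /= r2; split=> Vm; (split; first by lia); split;
    rewrite /= /upd //=.
  - by move: kk'; rewrite /mid; lia.
  - by lia.
  - move=> p pm; have [->//|/eqP ne] := eqVneq p mid.
    by apply: sw_trans Vm => //; apply: fV; lia.
  - by move: kk'; rewrite /mid; lia.
  - by lia.
  - move=> p pm; have [->//|/eqP ne] := eqVneq p mid.
    by apply: contra Vm; apply: sw_trans => //; apply: fV; lia.
- by rewrite /J s6 s7 subn0; split=> //; [rewrite leqnn | move=> p; lia].
Qed.

(* Position [i] of the enumeration [A] lies on pile [lb i]; [tl] holds the tops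
   of the [m] piles and [pr] the top of the pile to the left at the time an item
   was placed. *)
Definition piles_inv j (lb : nat -> nat) m (tl pr : nat -> nat) :=
  [/\ m <= j /\ (0 < j -> 0 < m),
      forall i, i < j -> lb i < m,
      (forall p, p < m -> exists2 i, i < j & tl p = A i /\ lb i = p) /\
      (forall p q, p < q < m -> V (tl p) (tl q)),
      (forall i, i < j -> ~~ V (A i) (tl (lb i))) /\
      (forall i i', i < i' < j -> V (A i) (A i') -> lb i != lb i')
    & forall i, i < j -> exists2 i', i' <= i & pr (A i) = A i' /\
        (0 < lb i -> [/\ i' < i, (lb i').+1 = lb i & V (A i') (A i)])].

Lemma piles_inv_place j lb m tl pr q : j < n -> piles_inv j lb m tl pr ->
  q <= m -> (forall p, p < q -> V (tl p) (A j)) ->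
  (forall p, q <= p < m -> ~~ V (tl p) (A j)) ->
  piles_inv j.+1 (upd lb j q) (if m <= q then q + 1 else m) (upd tl q (A j))
    (upd pr (A j) (upd tl q (A j) (q - 1))).
Proof.
move=> jn [[mj m0] lbm [tlA tlV] [dV eV] prA] qm lo hi.
set m' := if _ then _ else _.
have mm' : m <= m' by rewrite /m'; case: ifP; lia.
have qm' : q < m' by rewrite /m'; case: ifP; lia.
have m'm p : p < m' -> p != q -> p < m by rewrite /m'; case: ifP => _ h /eqP; lia.
have lbE i : i < j -> upd lb j q i = lb i by move=> ij; rewrite /upd ifN //;
  apply/eqP; lia.
have lbj : upd lb j q j = q by rewrite /upd eqxx.
have caseS i : i < j.+1 -> i = j \/ i < j by lia.
have asym : forall a b, V a b -> ~~ V b a by case: sw.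
split.
- by split; [rewrite /m'; case: ifP; lia|lia].
- by move=> i /caseS[->|ij]; rewrite ?lbj // lbE //; apply: leq_trans mm'; apply: lbm.
- split=> [p pm|p p'].
    have [->|pq] := eqVneq p q; first by exists j => //; rewrite /upd !eqxx.
    have [i ij [ti li]] := tlA p (m'm _ pm pq); exists i; first by lia.
    by rewrite lbE // /upd (negPf pq).
  rewrite /upd => /andP[pp' pm]; have [eq|pq] := eqVneq p q.
    have p'q : p' != q by apply/eqP; lia.
    have p'm := m'm _ pm p'q; rewrite (negPf p'q).
    apply: (sw_nlt_lt (b := tl q)) => //; first by apply: hi; lia.
    by apply: tlV; lia.
  have [eq|p'q] := eqVneq p' q; first by apply: lo; lia.
  by apply: tlV; rewrite pp' (m'm _ pm p'q).
- split=> [i /caseS[->|ij]|i i' /andP[ii' /caseS[e'|ij]]].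
  + by rewrite lbj /upd eqxx sw_irr.
  + rewrite lbE // /upd; case: eqP => [lq|_]; last exact: dV.
    apply: (sw_ntrans (b := tl q)); [exact: sw|by rewrite -lq; apply: dV|].
    by apply: hi; rewrite leqnn -lq; apply: lbm.
  + rewrite e' lbj lbE -?e' // => Vij; apply/eqP => lq.
    have lqm : q < m by rewrite -lq; apply: lbm; lia.
    have nV : ~~ V (A i) (tl q) by rewrite -lq; apply: dV; lia.
    have nV2 : ~~ V (tl q) (A j) by apply: hi; rewrite leqnn.
    by move: Vij; rewrite e' (negPf (sw_ntrans sw nV nV2)).
  + by rewrite !lbE; [apply: eV; rewrite ii'|lia|lia].
- move=> i /caseS[->|ij].
    rewrite lbj {1}/upd eqxx; case: q qm lo hi @m' mm' qm' m'm lbE lbj =>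
      [|q] qm lo hi m' mm' qm' m'm lbE lbj.
      by exists j => //; rewrite /upd eqxx.
    have [i' ij' [ti li]] := tlA q qm; exists i'; first by lia.
    have -> : upd tl q.+1 (A j) (q.+1 - 1) = tl q.
      by rewrite subn1 /= /upd ifN //; apply/eqP; lia.
    by split=> // _; split; rewrite ?lbE ?li // -ti; apply: lo.
  have [i' ii' [pi hi']] := prA i ij; exists i' => //.
  rewrite {1}/upd (negPf (A_neq _ _ _)) ?pi; [|lia|lia|by apply/eqP; lia].
  by split=> //; rewrite !lbE //; lia.
Qed.

Definition piles_cost k := 2 + n.+1 * (5 + (straight_cost search_start +
  (search_cost k + straight_cost place) + 4)).+1.

Lemma runs_piles k (s : state R) : n < 2 ^ k ->
  means [:: 0; 3; 4] s val_exp V -> ireg s 0 = n -> iarr s 2 = A -> ireg s 5 = 0 ->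
  runs w piles s (piles_cost k)
    (fun s' => exists lb, piles_inv n lb (ireg s' 5) (iarr s' 3) (iarr s' 4)).
Proof.
move=> nk hV s0n sA s5.
apply: (@runs_for _ _ (fun j s' => exists lb,
  piles_inv j lb (ireg s' 5) (iarr s' 3) (iarr s' 4)) 3 _ _ n) => //.
- by lia.
- by move=> j s1 [_ fr _] _; rewrite /= fr // s0n.
- exists (fun=> 0); rewrite /= /upd /= s5; split=> //.
    by split=> // p q; rewrite ltn0 andbF.
  by split=> // i i'; rewrite ltn0 andbF.
- move=> j s1 jn f1 kj [lb inv].
  have [[mj m0] lbm [tlA tlV] _ _] := inv.
  have a2 : iarr s1 2 = A by case: f1 => _ _ ->.
  apply: runs_seq; apply: runs_weaken (runs_wp (_ : wp w _ _ _)) (leqnn _) _.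
    rewrite /= /upd /= a2 kj; split; first by have := An jn; lia.
    split; first by lia.
    split; first by lia.
    exact: erefl.
  move=> s2 <-.
  apply: runs_seq_framed (runs_search (k := k) _ _ _ _ _ _ _) _ => //.
  + apply: means_frame _ (_ : frame (regs_written piles) (arrs_written piles) s _) hV.
      by move=> x; rewrite /= !inE; do ?case: eqP.
    apply: (frame_trans f1); split=> // x.
    by rewrite /= /upd !inE; do ?case: eqP.
  + by rewrite /= /upd /=; lia.
  + by rewrite /= /upd /=; lia.
  + move=> p; rewrite /= /upd /= => /tlA [i ij [-> _]]; apply: An; lia.
  + move=> s3 [_ fr3 fa3] []; rewrite /= /upd /= => qm lo hi.
    have e5 : ireg s3 5 = ireg s1 5 by rewrite fr3.
    have e2 : ireg s3 2 = A j by rewrite fr3.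
    have a3 : iarr s3 3 = iarr s1 3 by rewrite fa3.
    have a4 : iarr s3 4 = iarr s1 4 by rewrite fa3.
    have [[_ _] _ _ _ prA] := inv.
    apply: runs_wp; rewrite /= e2 /upd2 /upd /= a3 e5.
    have := piles_inv_place jn inv qm lo hi.
    rewrite /upd => H.
    split; first by have := An jn; lia.
    split.
      case: eqP => [_|ne]; first by have := An jn; lia.
      have [|i ij [-> _]] := tlA (ireg s3 6 - 1); first by lia.
      by have := An (ltn_trans ij jn); lia.
    split=> c.
      split; first by lia.
      by exists (upd lb j (ireg s3 6)); move: H; rewrite a4 c.
    by exists (upd lb j (ireg s3 6)); move: H; rewrite a4 (negPf c).
Qed.

Definition trace_cost := n.+1 * (3 + straight_cost trace_step).+1.

(* The marked items form the part of a longest chain on the piles [k], ...,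
   [m - 1]; the next item to mark is the one in register 1. *)
Definition trace_inv lb m k (s : state R) :=
  [/\ ireg s 5 = k /\ k <= m,
      0 < k -> exists2 i, i < n & [/\ ireg s 1 = A i, (lb i).+1 = k
        & forall i', i' < n -> iarr s 0 (A i') != 0 -> i < i' /\ V (A i) (A i')],
      forall x, iarr s 0 x != 0 -> exists2 i, i < n & x = A i,
      forall i i', i < i' < n -> iarr s 0 (A i) != 0 -> iarr s 0 (A i') != 0 ->
        V (A i) (A i')
    & forall p, k <= p < m -> exists i, [/\ i < n, iarr s 0 (A i) != 0 & lb i = p]].

Lemma runs_trace lb m (s : state R) : m <= n ->
  (forall i, i < n -> exists2 i', i' <= i & iarr s 4 (A i) = A i' /\
        (0 < lb i -> [/\ i' < i, (lb i').+1 = lb i & V (A i') (A i)])) ->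
  trace_inv lb m m s ->
  runs w trace s trace_cost (trace_inv lb m 0).
Proof.
move=> mn hpr inv.
apply: (@runs_weaken _ _ _ _ (m.+1 * (3 + straight_cost trace_step).+1) _ (trace_inv lb m 0)) => //; last first.
  by rewrite leq_mul2r; lia.
apply: (@runs_while _ _ (trace_inv lb m)) => //=.
- move=> k s1 _ h; have [[e5 _] _ _ _ _] := h; rewrite e5 -ltnNge => k0.
  by have -> : 0 = k by lia.
- move=> k s1 [rr fr fa] [[e5 km] hcur hin hV hcov]; rewrite e5 => k0; split=> //.
  have [i ni [e1 li hi]] := hcur k0.
  have a4 : iarr s1 4 = iarr s 4 by rewrite fa.
  have [i' ii' [pi hi']] := hpr i ni.
  have i'n : i' < n by lia.
  apply: runs_wp; rewrite /= /upd2 /upd /= a4 e1 pi e5.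
  split; first by lia.
  split; first by have := An i'n; lia.
  split; first by lia.
  have mk j : j < n -> ((if A j == A i then 1 else iarr s1 0 (A j)) != 0) ->
      j = i \/ [/\ i < j, V (A i) (A j) & iarr s1 0 (A j) != 0].
    move=> jn; have [->|ji] := eqVneq j i; first by left.
    by rewrite (negPf (A_neq _ _ _)) // => h; right; have [] := hi _ jn h.
  split; rewrite /= /upd2 /upd /=.
  - by rewrite subn1; split=> //; lia.
  - move=> k1; exists i' => //; have [|i'i li' Vi] := hi'; first by lia.
    split=> //; first by lia.
    move=> j jn /(mk _ jn) [->//|[ij Vij _]]; split; first by lia.
    exact: sw_trans Vi Vij.
  - by move=> x; case: ifP => [/eqP -> _|_ /hin//]; exists i.
  - move=> j j' jj' /mk h /mk h'; have {}h := h ltac:(lia); have {}h' :=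
      h' ltac:(lia).
    case: h h' => [ej|[ij Vij mj]] [ej'|[ij' Vij' mj']]; last exact: hV.
    + by move: jj'; rewrite ej ej' ltnn.
    + by rewrite ej.
    + by move: jj'; rewrite ej'; lia.
  - move=> p pm; have [pk|pk] := leqP k p.
      have [|j [jn mj lj]] := hcov p; first by lia.
      by exists j; split=> //; case: ifP.
    by exists i; split; rewrite ?eqxx //; lia.
Qed.

Definition chain_marked (out : nat -> nat) :=
  [/\ forall x, out x != 0 -> exists2 i, i < n & x = A i,
      forall i i', i < i' < n -> out (A i) != 0 -> out (A i') != 0 -> V (A i) (A i')
    & exists m lb, [/\ forall i, i < n -> lb i < m,
        forall i i', i < i' < n -> V (A i) (A i') -> lb i != lb i'
      & forall p, p < m -> exists i, [/\ i < n, out (A i) != 0 & lb i = p]]].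


End LongestChain.

Lemma runs_longest_chain val_exp : exists C, forall (R : realType) w n (V :
  rel nat) A (s : state R),
  strict_weak V -> n + n + 2 <= w -> (forall j, j < n -> A j < n) ->
  (forall i j, i < j < n -> A i != A j) -> means [:: 0; 3; 4] s val_exp V ->
  ireg s 0 = n -> 0 < n -> iarr s 2 = A -> (forall x, iarr s 0 x = 0) ->
  runs w (longest_chain val_exp) s (C * nlogn n)
    (fun s' => chain_marked n V A (iarr s' 0)).
Proof.
pose c1 := straight_cost search_start; pose c2 := straight_cost place.
pose c3 := straight_cost (search_step val_exp); pose c4 := straight_cost trace_step.
exists (2 + ((2 + ((c1 + c2 + 10) + 2 * (4 + c3).+1)) + (5 + (3 + c4).+1))).
move=> R w n V A s sw nw An Ai hV s0n n0 sA out0.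
set k := (trunc_log 2 n).+1.
have nk : n < 2 ^ k by exact: trunc_log_ltn.
apply: (@runs_weaken _ _ _ _ (2 + (piles_cost val_exp n k + (5 + trace_cost n))) _
  (fun s' => chain_marked n V A (iarr s' 0))) => //; last first.
  apply: leq_add_nlogn; first exact: leq_nlogn.
  apply: leq_add_nlogn.
    apply: leq_loop_nlogn; rewrite /search_cost -/c1 -/c2 -/c3 -/k.
    have : c1 + c2 + 10 <= (c1 + c2 + 10) * k by rewrite leq_pmulr.
    have : k.+1 * (4 + c3).+1 <= 2 * (4 + c3).+1 * k.
      by rewrite mulnAC leq_mul2r; lia.
    rewrite mulnDl; lia.
  apply: leq_add_nlogn; first exact: leq_nlogn.
  rewrite /trace_cost -/c4 mulnC leq_mul2l /nlogn; apply/orP; right.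
  exact: leq_pmulr.
apply: runs_seq; apply: runs_weaken (runs_wp (_ : wp w _ _ _)) (leqnn _) _.
  by rewrite /=; split; last exact: erefl.
move=> s1 <-.
apply: (runs_seq_framed _ (runs_piles (k := k) sw nw An Ai _ _ _ _ _)) => //.
move=> s2 [_ _ fa] [lb [[mn m0] lbm [tlA tlV] [_ eV] prA]].
apply: runs_seq; apply: runs_weaken (runs_wp (_ : wp w _ _ _)) (leqnn _) _.
  rewrite /=; split; last exact: erefl.
  have [|i ni [-> _]] := tlA (ireg s2 5 - 1); first by have := m0 n0; lia.
  by have := An i ni; lia.
move=> s3 <-.
have a0 x : iarr s2 0 x = 0 by rewrite fa //; exact: out0.
apply: runs_weaken (runs_trace sw nw An Ai (lb := lb) (m :=
  ireg s2 5) _ _ _) (leqnn _) _ => //.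
  split; rewrite /= /upd /=.
  - by split.
  - move=> m1; have [|i ni [ti li]] := tlA (ireg s2 5 - 1); first by lia.
    exists i => //; split=> //; first by lia.
    by move=> i' _; rewrite a0.
  - by move=> x; rewrite a0.
  - by move=> i i' _; rewrite a0.
  - by move=> p; lia.
move=> s4 [_ _ hin hc hcov]; split=> //.
by exists (ireg s2 5), lb; split.
Qed.

(** * Classes and strips along one axis *)

Section Comparisons.
Local Open Scope ring_scope.

Definition key_real (e : iexp -> rexp) a b := BNot (RLe (e (IReg b)) (e (IReg a))).
Definition key_nat (e : iexp -> iexp) a b := ilt (e (IReg a)) (e (IReg b)).
Definition key_lex (c1 c2 : nat -> nat -> bexp) a b :=
  bor (c1 a b) (BAnd (BNot (c1 b a)) (c2 a b)).

Variables (R : realType) (E : seq nat) (s0 : state R).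

Lemma beval_bor (s : state R) b1 b2 : beval s (bor b1 b2) = beval s b1 || beval s b2.
Proof. by rewrite /= negb_and !negbK. Qed.

Lemma beval_ilt (s : state R) e1 e2 :
  beval s (ilt e1 e2) = (ieval s e1 < ieval s e2)%N.
Proof. by rewrite /= ltnNge. Qed.

Lemma means_real e (f : nat -> R) :
  (forall s, rarr s = rarr s0 -> (forall a, a \notin E -> iarr s a = iarr s0 a) ->
     forall i, reval s (e i) = f (ieval s i)) ->
  means E s0 (key_real e) (fun a b => f a < f b).
Proof. by move=> h s rs as_ x y; rewrite /= !h // -ltNge. Qed.

Lemma means_nat e (f : nat -> nat) :
  (forall s, rarr s = rarr s0 -> (forall a, a \notin E -> iarr s a = iarr s0 a) ->
     forall i, ieval s (e i) = f (ieval s i)) ->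
  means E s0 (key_nat e) (fun a b => (f a < f b)%N).
Proof. by move=> h s rs as_ x y; rewrite /= !h // -ltnNge. Qed.

Lemma means_lex c1 c2 r1 r2 : means E s0 c1 r1 -> means E s0 c2 r2 ->
  means E s0 (key_lex c1 c2) (lex r1 r2).
Proof. by move=> h1 h2 s rs as_ x y; rewrite beval_bor /= !h1 // h2. Qed.

Lemma means_rev c r : means E s0 c r ->
  means E s0 (fun a b => c b a) (rev_rel r).
Proof. by move=> h s rs as_ x y; apply: h. Qed.

End Comparisons.

Lemma lex_ltn_total (r : rel nat) a b :
  a != b -> lex r ltn a b || lex r ltn b a.
Proof.
by rewrite neq_ltn /lex; case: (r a b); case: (r b a) => //=; rewrite orbT.
Qed.

Lemma lex_total (T : eqType) (r1 r2 : rel T) (a b : T) :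
  r2 a b || r2 b a -> lex r1 r2 a b || lex r1 r2 b a.
Proof. by rewrite /lex; case: (r1 a b); case: (r1 b a) => //=; rewrite ?orbT. Qed.

Lemma sw_ltn : strict_weak ltn.
Proof. exact: (sw_key (fun i : nat => i)). Qed.

Section Axis.
Local Open Scope ring_scope.
Variables (p e C S G J : nat).

Definition len2 i :=
  RMul (RSub (RGet e i) (RGet p i)) (RSub (RGet e i) (RGet p i)).

Definition class_cmp := key_lex (key_real len2) (key_nat id).
Definition class_fresh a b := RLe (RMul (RConst 4) (len2 (IReg a))) (len2 (IReg b)).

Definition strip_cmp :=
  key_lex (key_nat (IGet C)) (key_lex (key_real (RGet p)) (key_nat id)).

Definition strip_fresh a b :=
  bor (bor (ilt (IGet C (IReg a)) (IGet C (IReg b)))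
           (ilt (IGet C (IReg b)) (IGet C (IReg a))))
      (RLe (len2 (IGet C (IReg a)))
           (RMul (RSub (RGet p (IReg b)) (RGet p (IReg a)))
                 (RSub (RGet p (IReg b)) (RGet p (IReg a))))).

Definition axis :=
  CSeq (tree_sort class_cmp)
 (CSeq (scan_com class_fresh C J)
 (CSeq (tree_sort strip_cmp)
       (scan_com strip_fresh S G))).

(* [c i] represents the class of items whose length is within a factor 2 of the
   length of [i], [st i] the strip of [i] in its class, and [rs i] is the number
   of this strip modulo 3. *)
Definition axis_spec (R : realType) n (x len : nat -> R) (c st rs : nat -> nat) :=
  [/\ forall i, (i < n)%N -> [/\ (c i < n)%N, (st i < n)%N & (rs i < 3)%N],
      forall i, (i < n)%N -> len (c i) <= len i < 2 * len (c i),
      forall i j, (i < n)%N -> (j < n)%N ->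
        [\/ c i = c j, 2 * len (c i) <= len (c j) | 2 * len (c j) <= len (c i)],
      forall i, (i < n)%N -> x (st i) <= x i < x (st i) + len (c i)
    & forall i j, (i < n)%N -> (j < n)%N -> c i = c j -> rs i = rs j ->
        [\/ st i = st j, x (st i) + 3 * len (c i) <= x (st j)
          | x (st j) + 3 * len (c i) <= x (st i)]].

Lemma runs_axis : exists K, forall (R : realType) w n (s : state R),
  C \notin [:: 1; 2; S; G; J]%N -> J != 2%N -> S != 2%N -> G != 2%N -> S != G ->
    (n + n + 2 <= w)%N -> ireg s 0 = n -> (0 < n)%N ->
  let x i := rarr s p i in let len i := `|rarr s e i - rarr s p i| in
  (forall i, (i < n)%N -> 0 < len i) ->
  runs w axis s (K * nlogn n)
    (fun s' => axis_spec n x len (iarr s' C) (iarr s' S) (iarr s' G)).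
Proof.
have [K1 sort1] := runs_sort class_cmp.
have [K2 scan1] := runs_scan class_fresh C J.
have [K3 sort2] := runs_sort strip_cmp.
have [K4 scan2] := runs_scan strip_fresh S G.
exists (K1 + (K2 + (K3 + K4)))%N => R w n s Cn J2 S2 G2 SG nw s0n n0 x len len0.
move: Cn; rewrite !inE !negb_or => /and5P[C1 C2 CS CG CJ].
have len2E (s' : state R) i : rarr s' = rarr s ->
  reval s' (len2 i) = len (ieval s' i) ^+ 2.
  by move=> rs; rewrite /= rs /len real_normK ?num_real // expr2.
rewrite !mulnDl.
pose r1 : rel nat := lex (fun a b => len a ^+ 2 < len b ^+ 2) ltn.
have sw1 : strict_weak r1 := sw_lex (sw_key (fun a => len a ^+ 2)) sw_ltn.
have m1 : means [:: 1; 2]%N s class_cmp r1.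
  apply: means_lex; first by apply: means_real => s' rs _ i; apply: len2E.
  exact: (means_nat (f := id)).
apply: runs_seq_framed (sort1 R w n _ s sw1 (@lex_ltn_total _) nw s0n m1) _ => //.
move=> s1 [rr1 fr1 fa1]; set A := iarr s1 2 => enA.
have n1 : ireg s1 0 = n by rewrite fr1.
pose fr a b := 4 * len a ^+ 2 <= len b ^+ 2.
have mfr : means [:: C; J] s1 class_fresh fr.
  move=> s' rs _ a b.
  rewrite -[LHS]/(4 * reval s' (len2 (IReg a)) <= reval s' (len2 (IReg b))).
  by rewrite !len2E ?rs.
have Aneq i j : (i < j < n)%N -> A i != A j := enumerates_neq sw1 enA.
apply: runs_seq_framed (scan1 R w n fr A s1 C2 J2 CJ nw n1 n0 erefl enA.1 Aneq mfr) _ => //.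
move=> s2 [rr2 fr2 fa2] /= scC.
have A_sorted i j : (i < j < n)%N -> len (A i) <= len (A j).
  move=> ij; have := enA.2 _ _ ij; rewrite /r1 /lex -leNgt => le.
  rewrite -(ler_pXn2r (n := 2)) ?nnegrE ?normr_ge0 //.
  by case/orP: le => [/ltW|/andP[]].
have [hdC hdC2] := scan_doubling len0 enA.1 A_sorted.
pose c := iarr s2 C.
have cA k : (k < n)%N -> c (A k) = (scan fr A k.+1).1 by move=> /scC [].
have c_lt i : (i < n)%N -> (c i < n)%N.
  by move=> /(enumerates_surj sw1 enA) [k kn <-]; rewrite cA //; have [] := hdC k kn.
have c_len i : (i < n)%N -> len (c i) <= len i < 2 * len (c i).
  move=> /(enumerates_surj sw1 enA) [k kn <-]; rewrite cA //.
  by have [_ -> ->] := hdC k kn.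
have c_sep i j : (i < n)%N -> (j < n)%N ->
  [\/ c i = c j, 2 * len (c i) <= len (c j) | 2 * len (c j) <= len (c i)].
  move=> /(enumerates_surj sw1 enA) [k kn <-] /(enumerates_surj sw1 enA) [l ln <-].
  rewrite !cA //; case: (leqP k l) => kl.
    have [|->|le] := hdC2 k l; first by rewrite kl.
      by constructor 1.
    by constructor 2.
  have [|->|le] := hdC2 l k; first by rewrite ltnW.
    by constructor 1.
  by constructor 3.
pose r2 : rel nat := lex (fun a b => (c a < c b)%N) (lex (fun a b => x a < x b) ltn).
have sw2 : strict_weak r2 := sw_lex (sw_key c) (sw_lex (sw_key x) sw_ltn).
have tot2 a b : a != b -> r2 a b || r2 b a.
  by move=> ab; apply: lex_total; apply: lex_ltn_total.
have n2 : ireg s2 0 = n by rewrite fr2.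
have rs2 : rarr s2 = rarr s by rewrite rr2 rr1.
have m2 : means [:: 1; 2]%N s2 strip_cmp r2.
  apply: means_lex.
    apply: means_nat => s' rs as_ i; rewrite /= as_ //.
    by rewrite !inE negb_or C1.
  apply: means_lex; last exact: (means_nat (f := id)).
  by apply: means_real => s' rs _ i; rewrite /= rs rs2.
apply: runs_seq_framed (sort2 R w n _ s2 sw2 tot2 nw n2 m2) _ => //.
move=> s3 [rr3 fr3 fa3]; set B := iarr s3 2 => enB.
have n3 : ireg s3 0 = n by rewrite fr3.
have c3 : iarr s3 C = c.
  by rewrite fa3 //= !inE !negb_or C1 C2.
pose fs a b := (c a != c b) || (len (c a) ^+ 2 <= (x b - x a) ^+ 2).
have rs3 : rarr s3 = rarr s by rewrite rr3.
have mfs : means [:: S; G] s3 strip_fresh fs.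
  move=> s' rs as_ a b.
  have c' : iarr s' C = c by rewrite as_ // !inE negb_or CS.
  rewrite /strip_fresh !beval_bor !beval_ilt -neq_ltn /fs [beval _ (RLe _ _)]/=.
  rewrite -[X in X <= _]/(reval s' (len2 (IGet C (IReg a)))) len2E ?rs //=.
  by rewrite c' rs3 expr2.
have Bneq i j : (i < j < n)%N -> B i != B j := enumerates_neq sw2 enB.
have fin := scan2 R w n fs B s3 S2 G2 SG nw n3 n0 erefl enB.1 Bneq mfs.
apply: runs_weaken (runs_framed _ fin) (leqnn _) _ => // s4 [[_ _ fa4] scS].
have c4 : iarr s4 C = c.
  by rewrite fa4 //= !inE !negb_or CS CG.
have B_sorted i j : (i < j < n)%N ->
    (c (B i) < c (B j))%N \/ c (B i) = c (B j) /\ x (B i) <= x (B j).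
  move=> ij; have := enB.2 _ _ ij; rewrite /r2 /lex => /orP[|/andP[cji]];
    first by left.
  rewrite -leqNgt leq_eqVlt in cji; case/orP: cji => [/eqP cij|]; last by left.
  by rewrite -leNgt => /orP[/ltW|/andP[le _]]; right.
have cn i : (i < n)%N -> (c i < n)%N /\ 0 < len (c i).
  by move=> ni; split; [exact: c_lt|exact: len0 (c_lt _ ni)].
have [hdS hdS2] := scan_strips cn enB.1 B_sorted.
have SB k : (k < n)%N -> iarr s4 S (B k) = (scan fs B k.+1).1 by move=> /scS [].
have GB k : (k < n)%N -> iarr s4 G (B k) = (scan fs B k.+1).2 by move=> /scS [].
rewrite c4; split=> //.
- move=> i ni; rewrite c_lt //; have [k kn <-] := enumerates_surj sw2 enB ni.
  rewrite SB // GB // scan_counter; split=> //.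
  by have [] := hdS k kn.
- move=> i ni; have [k kn <-] := enumerates_surj sw2 enB ni.
  by rewrite SB //; have [_ -> ->] := hdS k kn.
move=> i j ni nj; have [k kn <-] := enumerates_surj sw2 enB ni.
have [l ln <-] := enumerates_surj sw2 enB nj; rewrite !SB // !GB // => ckl tkl.
case: (leqP k l) => kl.
  have kln : (k <= l < n)%N by rewrite kl.
  have [->|le] := hdS2 k l kln ckl tkl; first by constructor 1.
  by constructor 2.
have lkn : (l <= k < n)%N by rewrite ltnW.
have [->|le] := hdS2 l k lkn (esym ckl) (esym tkl); first by constructor 1.
by constructor 3; rewrite ckl.
Qed.

End Axis.

(** * Geometry of two l's of the same shape *)

Section Geometry.
Local Open Scope ring_scope.
Local Open Scope classical_set_scope.
Variable R : realType.
Implicit Types l m : ell R.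

Definition pointing_right l := ell_x l <= ell_xh l.
Definition pointing_up l := ell_y l <= ell_yv l.

(* Two nearby l's of the same shape are disjoint exactly when one has a smaller
   abscissa and a smaller [slant] than the other. *)
Definition slant l :=
  if pointing_right l == pointing_up l then ell_y l else - ell_y l.

Lemma ell_points_box l p : ell_points l p ->
  Num.min (ell_x l) (ell_xh l) <= p.1 <= Num.max (ell_x l) (ell_xh l) /\
  Num.min (ell_y l) (ell_yv l) <= p.2 <= Num.max (ell_y l) (ell_yv l).
Proof.
by case=> [[h ->]|[-> h]]; split=> //; rewrite ge_min le_max lexx.
Qed.

Lemma far_intervals (x e x' e' u v a t : R) : (x <= e) = (x' <= e') ->
  `|e - x| < 2 * a -> `|e' - x'| < 2 * a -> u <= x < u + a -> v <= x' < v + a ->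
  u + 3 * a <= v ->
  Num.min x e <= t <= Num.max x e -> Num.min x' e' <= t <= Num.max x' e' -> False.
Proof.
move=> sh /ltr_normlP[h1 h2] /ltr_normlP[h3 h4] /andP[h5 h6] /andP[h7 h8] h9.
have [xe|ex] := leP x e; move: sh; rewrite ?xe ?leNgt ?ex /=.
  by move=> /esym; case: leP => // x'e' _ /andP[? ?] /andP[? ?]; lra.
by move=> /esym/negPf; case: leP => // x'e' _ /andP[? ?] /andP[? ?]; lra.
Qed.

Lemma slanted_disjoint l m p : pointing_right l = pointing_right m ->
  pointing_up l = pointing_up m -> ell_x l < ell_x m -> slant l < slant m ->
  ell_points l p -> ell_points m p -> False.
Proof.
case: l m p => [x y e f nx ny] [x' y' e' f' nx' ny'] [p q].
rewrite /slant /pointing_right /pointing_up /ell_points /horizontal_arm /vertical_arm /=.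
case: (leP x e) => xe; case: (leP x' e') => xe' // _;
  case: (leP y f) => yf; case: (leP y' f') => yf' //= _ xx yy;
  case=> -[] => [/andP[h1 h2] h3|h3 /andP[h1 h2]];
  case=> -[] => [/andP[h4 h5] h6|h6 /andP[h4 h5]]; lra.
Qed.

Lemma slanted_meet l m a b : pointing_right l = pointing_right m ->
  pointing_up l = pointing_up m ->
  a <= horizontal_length l -> a <= horizontal_length m ->
  b <= vertical_length l -> b <= vertical_length m ->
  `|ell_x l - ell_x m| < a -> `|ell_y l - ell_y m| < b ->
  ell_x l <= ell_x m -> slant m <= slant l ->
  ell_points l `&` ell_points m !=set0.
Proof.
case: l m => [x y e f nx ny] [x' y' e' f' nx' ny'].
rewrite /slant /pointing_right /pointing_up /horizontal_length /vertical_length /=.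
move=> hr hu hl hl' vl vl' /ltr_normlP[xa xa'] /ltr_normlP[ya ya'] xx yy.
exists (if x <= e then (x', y) else (x, y')).
rewrite /ell_points /horizontal_arm /vertical_arm /=.
have normE (u v : R) : `|v - u| = if u <= v then v - u else u - v.
  by case: leP => h; [rewrite ger0_norm // subr_ge0|rewrite ltr0_norm ?subr_lt0 //
    opprB].
move: hr hu hl hl' vl vl' yy; rewrite !normE.
case: (leP x e) => xe; case: (leP x' e') => xe' // _;
  case: (leP y f) => yf; case: (leP y' f') => yf' //= _ hl hl' vl vl' yy;
  first [split; [left|right]; split=> //=; apply/andP; split; lra
        |split; [right|left]; split=> //=; apply/andP; split; lra].
Qed.
End Geometry.

(** * Counting classes and chains *)

Section ClassCount.
Local Open Scope ring_scope.
Variable R : realType.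

Lemma log2_double (x : R) : 0 < x -> log2 (2 * x) = 1 + log2 x.
Proof.
move=> x0; rewrite /log2 lnM ?posrE // mulrDl divff //.
by rewrite gt_eqF // ln_gt0 // ltr1n.
Qed.

Lemma ler_log2 (x y : R) : 0 < x -> x <= y -> log2 x <= log2 y.
Proof.
move=> x0 xy; rewrite /log2 ler_wpM2r ?invr_ge0 ?ln_ge0 ?ler1n //.
by rewrite ler_ln ?posrE // (lt_le_trans x0).
Qed.

Lemma log2_1 : log2 (1 : R) = 0.
Proof. by rewrite /log2 ln1 mul0r. Qed.

Lemma card_doubling (T : finType) (f : T -> R) (C : {set T}) lo hi :
  0 < lo -> lo <= hi -> (forall i, lo <= f i <= hi) ->
  (forall i j, i \in C -> j \in C -> i != j -> 2 * f i <= f j \/ 2 * f j <= f i) ->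
  #|C|%:R <= log2 (2 * (hi / lo)).
Proof.
move=> lo0 lohi fb sep.
have d1 : 1 <= hi / lo by rewrite ler_pdivlMr // mul1r.
rewrite log2_double ?(lt_le_trans ltr01) //.
pose g i := log2 (f i / lo).
have fl i : 1 <= f i / lo by rewrite ler_pdivlMr // mul1r; have /andP[] := fb i.
have g0 i : 0 <= g i by rewrite -log2_1; apply: ler_log2.
have gM i : g i <= log2 (hi / lo).
  apply: ler_log2; first exact: lt_le_trans (fl i).
  by rewrite ler_pM2r ?invr_gt0 //; have /andP[] := fb i.
have g2 i j : 2 * f i <= f j -> (Num.truncn (g i) < Num.truncn (g j))%N.
  move=> le; have : g i + 1 <= g j.
    rewrite addrC -log2_double ?(lt_le_trans ltr01) // mulrA; apply: ler_log2.
      by rewrite -mulrA mulr_gt0 // (lt_le_trans ltr01).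
    by rewrite ler_pM2r // invr_gt0.
  move=> le1; rewrite truncn_ge_nat // -natr1; apply: le_trans le1.
  by rewrite lerD2r truncn_le.
set K := Num.truncn (log2 (hi / lo)).
have gK i : (Num.truncn (g i) < K.+1)%N.
  rewrite ltnS truncn_ge_nat; last by rewrite -log2_1 ler_log2.
  by apply: le_trans (gM i); rewrite truncn_le.
have inj : {in C &, injective (fun i => inord (Num.truncn (g i)) : 'I_K.+1)}.
  move=> i j iC jC /(congr1 val); rewrite /= !inordK // => e.
  apply/eqP; apply/negPn/negP => ij.
  by have [/g2|/g2] := sep i j iC jC ij; rewrite e ltnn.
apply: (@le_trans _ _ K.+1%:R).
  by rewrite ler_nat -(card_in_imset inj) -[leqRHS]card_ord max_card.
by rewrite -natr1 addrC lerD2l truncn_le -log2_1 ler_log2.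
Qed.
End ClassCount.


Section Chains.
Local Open Scope nat_scope.

Definition tie (T : Type) (r : rel T) : rel T := fun a b => ~~ r a b && ~~ r b a.

Lemma tie_lex T (r1 r2 : rel T) a b : tie (lex r1 r2) a b = tie r1 a b && tie r2 a b.
Proof.
rewrite /tie /lex.
by case: (r1 a b); case: (r1 b a); case: (r2 a b); case: (r2 b a).
Qed.

Lemma tie_nat (T : Type) (f : T -> nat) a b : tie (fun a b =>
  f a < f b) a b = (f a == f b).
Proof. by rewrite /tie -!leqNgt eqn_leq andbC. Qed.

(* Positions compare groups upwards and values compare them downwards, so that
   a chain stays inside one group. *)
Section Positions.
Variables (T : Type) (g c x k t : rel T).

Definition position := lex g (lex c (lex x (lex (rev_rel k) t))).
Definition value := lex (rev_rel g) (lex c k).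

Hypotheses (sg : strict_weak g) (sc : strict_weak c) (sx : strict_weak x).
Hypothesis sk : strict_weak k.

Lemma position_value a b : position a b -> value a b ->
  tie g a b /\ (c a b \/ tie c a b /\ x a b /\ k a b).
Proof.
have := (sg.1 a b, sg.1 b a, sc.1 a b, sc.1 b a, sk.1 a b, sk.1 b a).
case=> -[[[[]]]]; rewrite /position /value /tie /lex /rev_rel.
case: (g a b); case: (g b a); case: (c a b); case: (c b a);
case: (k a b); case: (k b a); case: (x a b); case: (x b a);
by rewrite /= ?andbF ?orbF => *; auto.
Qed.

Lemma cell_position_value a b : tie g a b -> c a b -> position a b && value a b.
Proof.
by rewrite /tie /position /value /lex /rev_rel => /andP[/negPf -> /negPf ->] ->.
Qed.

Lemma slope_position_value a b : tie g a b -> tie c a b -> x a b -> k a b ->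
  position a b && value a b.
Proof.
rewrite /tie /position /value /lex /rev_rel.
by move=> /andP[/negPf -> /negPf ->] /andP[/negPf -> /negPf ->] -> ->; rewrite orbT.
Qed.
End Positions.

Lemma chain_marked_items n (r V : rel nat) A out : strict_weak r -> strict_weak V ->
  enumerates r n A -> chain_marked n V A out ->
  (forall i j, out i != 0 -> out j != 0 -> i != j ->
     (r i j && V i j) || (r j i && V j i)) /\
  exists m lb, [/\ forall i, i < n -> lb i < m,
    forall i j, i < n -> j < n -> r i j && V i j -> lb i != lb j
    & m <= #|[set i : 'I_n | out i != 0]|].
Proof.
move=> sr sV en [hin hV [m [lb [lbm lbV cov]]]]; have [An Ar] := en.
split=> [i j mi mj|].
  have [[k kn ik] [l ln jl]] := (hin _ mi, hin _ mj); move: mi mj; rewrite ik jl =>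
    mi mj.
  case: (ltngtP k l) => [kl _|lk _|->]; last by rewrite eqxx.
    have kln : k < l < n by rewrite kl.
    by rewrite (Ar _ _ kln) (hV _ _ kln).
  have lkn : l < k < n by rewrite lk.
  by rewrite (Ar _ _ lkn) (hV _ _ lkn) //= orbT.
pose pos i := index i [seq A k | k <- iota 0 n].
have posA k : k < n -> pos (A k) = k.
  move=> kn; have sz :
    size [seq A k | k <- iota 0 n] = n by rewrite size_map size_iota.
  have nthA j : j < n -> nth 0 [seq A k | k <- iota 0 n] j = A j.
    by move=> jn; rewrite (nth_map 0) ?size_iota // nth_iota.
  rewrite /pos -[A k]nthA // index_uniq ?sz //.
  rewrite map_inj_in_uniq ?iota_uniq // => i j.
  rewrite !mem_iota !add0n => ni nj e.
  case: (ltngtP i j) => // h.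
    by have := @enumerates_neq _ _ _ i j sr en; rewrite h nj e eqxx => /(_ isT).
  by have := @enumerates_neq _ _ _ j i sr en; rewrite h ni e eqxx => /(_ isT).
exists m, (lb \o pos); split=> /=.
- by move=> i /(enumerates_surj sr en) [k kn <-]; rewrite posA //; apply: lbm.
- move=> i j /(enumerates_surj sr en) [k kn <-] /(enumerates_surj sr en) [l ln <-].
  rewrite !posA // => /andP[rkl Vkl]; apply: lbV => //; rewrite ln andbT.
  case: (ltngtP k l) => // [lk|e]; last by move: rkl; rewrite e sw_irr.
  by have := sr.1 _ _ rkl; rewrite Ar // lk.
case: m lbm cov => // m lbm cov.
pose O := [set i : 'I_n | out i != 0].
pose f (i : 'I_n) : 'I_m.+1 := inord (lb (pos i)).
have <- : #|f @: O| = m.+1; last exact: leq_imset_card.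
rewrite -[RHS]card_ord -cardsT; congr #|pred_of_set _|; apply/setP => p; rewrite inE.
have [i [ni mi li]] := cov p (ltn_ord p).
apply/imsetP; exists (Ordinal (An i ni)); first by rewrite inE.
by apply: val_inj; rewrite /f /= posA // inordK ?li.
Qed.
End Chains.

(** * Groups and cells *)

Lemma sw_nat T (f : T -> nat) : strict_weak (fun a b => f a < f b)%N.
Proof. exact: (sw_key f). Qed.

Section AxisTheory.
Local Open Scope ring_scope.
Variables (R : realType) (n : nat) (x e : nat -> R) (c st rs : nat -> nat).
Let len i := `|e i - x i|.
Hypothesis spec : axis_spec n x len c st rs.

Lemma strips_far i j t : (i < n)%N -> (j < n)%N -> c i = c j -> rs i = rs j ->
  st i != st j -> (x i <= e i) = (x j <= e j) ->
  Num.min (x i) (e i) <= t <= Num.max (x i) (e i) ->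
  Num.min (x j) (e j) <= t <= Num.max (x j) (e j) -> False.
Proof.
have [_ clen _ xst far] := spec => ni nj cij rij sij dir ti tj.
have /andP[_ li] := clen i ni; have /andP[_ lj] := clen j nj.
have [xi xj] := (xst i ni, xst j nj); rewrite -cij in xj lj.
have [sij'|le|le] := far i j ni nj cij rij.
- by rewrite sij' eqxx in sij.
- exact: far_intervals dir li lj xi xj le ti tj.
- exact: far_intervals (esym dir) lj li xj xi le tj ti.
Qed.

Lemma strip_near i j : (i < n)%N -> (j < n)%N -> c i = c j -> st i = st j ->
  `|x i - x j| < len (c i).
Proof.
have [_ _ _ xst _] := spec => ni nj cij sij.
have /andP[i1 i2] := xst i ni; have /andP[j1 j2] := xst j nj.
by rewrite -cij -sij in j1 j2; rewrite ltr_norml; apply/andP; split; lra.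
Qed.

End AxisTheory.

Section Selection.
Local Open Scope ring_scope.
Variables (R : realType) (n : nat) (L : 'I_n -> ell R).
Variables cx sx rx cy sy ry : nat -> nat.

Let s0 := input_state L.

Definition right_of (s : state R) i := rarr s 0 i <= rarr s 2 i.
Definition up_of (s : state R) i := rarr s 1 i <= rarr s 3 i.
Definition slant_of (s : state R) i :=
  if right_of s i == up_of s i then rarr s 1 i else 0 - rarr s 1 i.

Definition group (s : state R) : rel nat :=
  lex (fun a b => right_of s a < right_of s b)%N
 (lex (fun a b => up_of s a < up_of s b)%N
 (lex (fun a b => cx a < cx b)%N (lex (fun a b => rx a < rx b)%N
 (lex (fun a b => cy a < cy b)%N (fun a b => ry a < ry b)%N)))).

Definition cell : rel nat := lex (fun a b => sx a < sx b)%N (fun a b =>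
  sy a < sy b)%N.
Definition abscissa (s : state R) : rel nat := fun a b => rarr s 0 a < rarr s 0 b.
Definition slope (s : state R) : rel nat := fun a b => slant_of s a < slant_of s b.

Lemma sw_group s : strict_weak (group s).
Proof.
apply: sw_lex; first exact: (sw_nat (fun i => right_of s i : nat)).
apply: sw_lex; first exact: (sw_nat (fun i => up_of s i : nat)).
by do ?apply: sw_lex; apply: sw_nat.
Qed.

Lemma sw_cell : strict_weak cell.
Proof. by apply: sw_lex; apply: sw_nat. Qed.

Lemma sw_position s :
  strict_weak (position (group s) cell (abscissa s) (slope s) ltn).
Proof.
apply: sw_lex (sw_group s) _; apply: sw_lex sw_cell _; apply: sw_lex.
  exact: (sw_key (rarr s 0)).
by apply: sw_lex sw_ltn; apply: sw_rev; apply: (sw_key (slant_of s)).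
Qed.

Lemma sw_value s : strict_weak (value (group s) cell (slope s)).
Proof.
apply: sw_lex; first exact: sw_rev (sw_group s).
by apply: sw_lex sw_cell _; apply: (sw_key (slant_of s)).
Qed.

Lemma tie_group s a b : tie (group s) a b ->
  [/\ right_of s a = right_of s b, up_of s a = up_of s b, cx a = cx b, cy a = cy b
    & rx a = rx b /\ ry a = ry b].
Proof.
rewrite /group !tie_lex !tie_nat => /and5P[/eqP r /eqP u /eqP -> /eqP ->
  /andP[/eqP -> /eqP ->]].
by split=> //; [move: r|move: u]; do 2!case: (_ s _).
Qed.

Lemma tie_groupE s a b : right_of s a = right_of s b -> up_of s a = up_of s b ->
  cx a = cx b -> cy a = cy b -> rx a = rx b -> ry a = ry b -> tie (group s) a b.
Proof.
by rewrite /group !tie_lex !tie_nat => -> -> -> -> -> ->; rewrite !eqxx.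
Qed.

Lemma tie_cell a b : tie cell a b = (sx a == sx b) && (sy a == sy b).
Proof. by rewrite /cell tie_lex !tie_nat. Qed.

Lemma input_rarr a (i : 'I_n) : rarr s0 a i = input_coord a (L i).
Proof. by rewrite /s0 /= valK. Qed.

Let x i := rarr s0 0 i.
Let y i := rarr s0 1 i.
Let lx i := `|rarr s0 2 i - rarr s0 0 i|.
Let ly i := `|rarr s0 3 i - rarr s0 1 i|.

Hypothesis spec_x : axis_spec n x lx cx sx rx.
Hypothesis spec_y : axis_spec n y ly cy sy ry.

Let P := position (group s0) cell (abscissa s0) (slope s0) ltn.
Let V := value (group s0) cell (slope s0).

Lemma right_ofE (i : 'I_n) : right_of s0 i = pointing_right (L i).
Proof. by rewrite /right_of !input_rarr. Qed.

Lemma up_ofE (i : 'I_n) : up_of s0 i = pointing_up (L i).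
Proof. by rewrite /up_of !input_rarr. Qed.

Lemma slant_ofE (i : 'I_n) : slant_of s0 i = slant (L i).
Proof. by rewrite /slant_of right_ofE up_ofE input_rarr sub0r. Qed.

Local Notation crosses i j :=
  (exists p, ell_points (L i) p /\ ell_points (L j) p).

Lemma chain_disjoint (i j : 'I_n) : P i j -> V i j -> ~ crosses i j.
Proof.
move=> Pij Vij [p [pi pj]].
have sk : strict_weak (slope s0) := sw_key (slant_of s0).
have [/tie_group[r u cxij cyij [rxij ryij]] pv] :=
  position_value (sw_group s0) sw_cell sk Pij Vij.
have [[xi yi] [xj yj]] := (ell_points_box pi, ell_points_box pj).
have near : tie cell i j.
  rewrite tie_cell; apply/andP; split; apply/negPn/negP => st_ij.
    apply: (strips_far spec_x (ltn_ord i) (ltn_ord j) cxij rxij st_ij (t :=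
      p.1)) => //;
    by rewrite /x !input_rarr.
  apply: (strips_far spec_y (ltn_ord i) (ltn_ord j) cyij ryij st_ij (t := p.2)) => //;
  by rewrite /y !input_rarr.
case: pv => [cij|[_ [xlt slt]]].
  by move: near; rewrite /tie cij.
move: r u xlt slt; rewrite /abscissa /slope !right_ofE !up_ofE !slant_ofE !input_rarr.
by move=> r u xlt slt; apply: slanted_disjoint r u xlt slt pi pj.
Qed.

Lemma disjoint_chain (i j : 'I_n) : tie (group s0) i j -> ~ crosses i j ->
  (P i j && V i j) || (P j i && V j i).
Proof.
move=> tg dis; have tg' : tie (group s0) j i by rewrite /tie andbC.
have [near|] := boolP (tie cell i j); last first.
  rewrite /tie negb_and !negbK => /orP[cij|cji]; apply/orP; [left|right].
    exact: cell_position_value tg cij.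
  exact: cell_position_value tg' cji.
have near' : tie cell j i by rewrite /tie andbC.
have [r u cxij cyij _] := tie_group tg.
move: (near); rewrite tie_cell => /andP[/eqP sxij /eqP syij].
have nx := strip_near spec_x (ltn_ord i) (ltn_ord j) cxij sxij.
have ny := strip_near spec_y (ltn_ord i) (ltn_ord j) cyij syij.
have [_ clx _ _ _] := spec_x; have [_ cly _ _ _] := spec_y.
have /andP[ai _] := clx i (ltn_ord i); have /andP[aj _] := clx j (ltn_ord j).
have /andP[bi _] := cly i (ltn_ord i); have /andP[bj _] := cly j (ltn_ord j).
rewrite -cxij in aj; rewrite -cyij in bj.
have nx' : `|x j - x i| < lx (cx i) by rewrite distrC.
have ny' : `|y j - y i| < ly (cy i) by rewrite distrC.
have lxE (k : 'I_n) : lx k = horizontal_length (L k) by rewrite /lx !input_rarr.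
have lyE (k : 'I_n) : ly k = vertical_length (L k) by rewrite /ly !input_rarr.
rewrite !right_ofE in r; rewrite !up_ofE in u.
rewrite !lxE in ai aj; rewrite !lyE in bi bj.
have meet_ij : x i <= x j -> slant_of s0 j <= slant_of s0 i -> crosses i j.
  rewrite !slant_ofE /x !input_rarr; apply: (slanted_meet r u ai aj bi bj).
    by move: nx; rewrite /x !input_rarr.
  by move: ny; rewrite /y !input_rarr.
have meet_ji : x j <= x i -> slant_of s0 i <= slant_of s0 j -> crosses i j.
  rewrite !slant_ofE /x !input_rarr => xx ss.
  have [||p [pj pi]] := slanted_meet (esym r) (esym u) aj ai bj bi _ _ xx ss.
  - by move: nx'; rewrite /x !input_rarr.
  - by move: ny'; rewrite /y !input_rarr.
  by exists p.
have [xlt|xgt|xe] := ltgtP (x i) (x j).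
- have slt : slope s0 i j by rewrite /slope ltNge; apply/negP => /(meet_ij (ltW xlt)).
  by apply/orP; left; apply: slope_position_value tg near xlt slt.
- have slt : slope s0 j i by rewrite /slope ltNge; apply/negP => /(meet_ji (ltW xgt)).
  by apply/orP; right; apply: slope_position_value tg' near' xgt slt.
exfalso; apply: dis; case: (leP (slant_of s0 i) (slant_of s0 j)) => [le|/ltW le].
  by apply: meet_ji => //; rewrite xe.
by apply: meet_ij => //; rewrite xe.
Qed.

Variable O : {set 'I_n}.

Lemma independent_chain :
  (forall i j, i \in O -> j \in O -> i != j ->
    (P i j && V i j) || (P j i && V j i)) ->
  independent (intersection_graph L) O.
Proof.
move=> ch; apply/'forall_implyP => i iO; apply/'forall_implyP => j jO.
rewrite /intersection_graph negb_and negbK; have [//|ij] := eqVneq i j.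
apply/asboolPn => -[p [pi pj]].
have [/andP[Pij Vij]|/andP[Pji Vji]] := orP (ch i j iO jO ij).
  by apply: (chain_disjoint Pij Vij); exists p.
by apply: (chain_disjoint Pji Vji); exists p.
Qed.

Let c_lt (z l : nat -> R) c st rs (sp : axis_spec n z l c st rs) (i : 'I_n) :
  (c i < n)%N.
Proof. by have [h _ _ _ _] := sp; have [] := h i (ltn_ord i). Qed.

Let rs_lt (z l : nat -> R) c st rs (sp : axis_spec n z l c st rs) (i : 'I_n) :
  (rs i < 3)%N.
Proof. by have [h _ _ _ _] := sp; have [] := h i (ltn_ord i). Qed.

Definition x_class (i : 'I_n) := Ordinal (c_lt spec_x i).
Definition y_class (i : 'I_n) := Ordinal (c_lt spec_y i).

Lemma independence_number_bound m (lb : nat -> nat) :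
  (forall i, i < n -> lb i < m)%N ->
  (forall i j, i < n -> j < n -> P i j && V i j -> lb i != lb j)%N ->
  (independence_number (intersection_graph L) <=
   36 * #|x_class @: [set: 'I_n]| * #|y_class @: [set: 'I_n]| * m)%N.
Proof.
move=> lbm lbV; apply/bigmax_leqP => I indI.
pose f (i : 'I_n) := (pointing_right (L i), pointing_up (L i),
  (x_class i, Ordinal (rs_lt spec_x i)), (y_class i, Ordinal (rs_lt spec_y i)),
  Ordinal (lbm i (ltn_ord i))).
have inj : {in I &, injective f}.
  move=> i j iI jI [r u [cxij] [rxij] [cyij] [ryij] lbij].
  apply/eqP/negPn/negP => ij.
  have tg : tie (group s0) i j by apply: tie_groupE; rewrite ?right_ofE ?up_ofE.
  have dis : ~ crosses i j.
    have := forall_inP (forall_inP indI i iI) j jI.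
    by rewrite /intersection_graph ij /= => /asboolPn h [p [pi pj]]; apply: h;
      exists p.
  have /orP[/(lbV i j (ltn_ord i) (ltn_ord j))|/(lbV j i (ltn_ord j) (ltn_ord i))] :=
    disjoint_chain tg dis; by rewrite lbij eqxx.
rewrite -(card_in_imset inj).
have sub : f @: I \subset finset.setX (finset.setX (finset.setX [set: bool * bool]
    (finset.setX (x_class @: [set: 'I_n]) [set: 'I_3]))
    (finset.setX (y_class @: [set: 'I_n]) [set: 'I_3])) [set: 'I_m].
  apply/fintype.subsetP => _ /imsetP[i _ ->]; rewrite !inE /=.
  by rewrite !imset_f ?inE.
apply: leq_trans (subset_leq_card sub) _.
by rewrite !cardsX !cardsT card_prod card_bool !card_ord; lia.
Qed.

End Selection.

(** * The program *)

Section FamilyExtrema.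
Local Open Scope ring_scope.
Variables (R : realType) (n : nat) (f : 'I_n -> R).
Hypothesis f0 : forall i, 0 < f i.

Lemma family_bounds i : family_min f <= f i <= family_max f.
Proof. by rewrite bigmin_le_cond //= le_bigmax. Qed.

Lemma family_min_gt0 : (0 < n)%N -> 0 < family_min f.
Proof.
move=> n0; apply/bigmin_gtP; split=> // .
by apply: lt_le_trans (f0 (Ordinal n0)) _; rewrite le_bigmax.
Qed.

Lemma card_classes (cl : 'I_n -> 'I_n) : (0 < n)%N ->
  (forall i j : 'I_n, [\/ cl i = cl j, 2 * f (cl i) <= f (cl j) | 2 * f (cl j) <=
    f (cl i)]) ->
  #|cl @: [set: 'I_n]|%:R <= log2 (2 * (family_max f / family_min f)).
Proof.
move=> n0 sep; apply: (card_doubling (f := f)).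
- exact: family_min_gt0.
- by have /andP[h1 h2] := family_bounds (Ordinal n0); apply: le_trans h1 h2.
- exact: family_bounds.
- move=> _ _ /imsetP[i _ ->] /imsetP[j _ ->].
  by have [->|h|h] := sep i j; [rewrite eqxx|left|right].
Qed.
End FamilyExtrema.

Definition bite b b1 b2 := bor (BAnd b b1) (BAnd (BNot b) b2).
Definition rlt e1 e2 := BNot (RLe e2 e1).

Definition right_exp i := RLe (RGet 0 i) (RGet 2 i).
Definition up_exp i := RLe (RGet 1 i) (RGet 3 i).
Definition key_bool (b : iexp -> bexp) x y := BAnd (BNot (b (IReg x))) (b (IReg y)).

Definition group_cmp :=
  key_lex (key_bool right_exp) (key_lex (key_bool up_exp)
 (key_lex (key_nat (IGet 5)) (key_lex (key_nat (IGet 7))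
 (key_lex (key_nat (IGet 8)) (key_nat (IGet 10)))))).

Definition cell_cmp := key_lex (key_nat (IGet 6)) (key_nat (IGet 9)).

Definition agree_exp i := bite (right_exp i) (up_exp i) (BNot (up_exp i)).

Definition slope_cmp x y :=
  let a := IReg x in let b := IReg y in
  let opp i := RSub (RConst 0) (RGet 1 i) in
  bite (agree_exp a)
    (bite (agree_exp b) (rlt (RGet 1 a) (RGet 1 b)) (rlt (RGet 1 a) (opp b)))
    (bite (agree_exp b) (rlt (opp a) (RGet 1 b)) (rlt (opp a) (opp b))).

Definition position_cmp :=
  key_lex group_cmp (key_lex cell_cmp (key_lex (key_real (RGet 0))
    (key_lex (fun a b => slope_cmp b a) (key_nat id)))).

Definition value_cmp :=
  key_lex (fun a b => group_cmp b a) (key_lex cell_cmp slope_cmp).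

Section Meanings.
Local Open Scope ring_scope.
Variables (R : realType) (s0 : state R) (E : seq nat).
Hypothesis disj : all (fun a => a \notin E) [:: 5; 6; 7; 8; 9; 10]%N.

Lemma beval_bite (s : state R) b b1 b2 :
  beval s (bite b b1 b2) = if beval s b then beval s b1 else beval s b2.
Proof. by rewrite beval_bor /=; case: (beval s b); rewrite /= ?orbF. Qed.

Lemma means_bool e (f : nat -> bool) :
  (forall s, rarr s = rarr s0 -> forall i, beval s (e i) = f (ieval s i)) ->
  means E s0 (key_bool e) (fun a b => f a < f b)%N.
Proof. by move=> h s rs as_ x y; rewrite /= !h //=; case: (f _); case: (f _). Qed.

Lemma means_array a : a \in [:: 5; 6; 7; 8; 9; 10]%N ->
  means E s0 (key_nat (IGet a)) (fun i j => iarr s0 a i < iarr s0 a j)%N.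
Proof.
move=> ain; apply: means_nat => s _ as_ i /=; rewrite as_ //.
exact: (allP disj).
Qed.

Lemma means_group : means E s0 group_cmp
  (group (iarr s0 5) (iarr s0 7) (iarr s0 8) (iarr s0 10) s0).
Proof.
apply: means_lex; first by apply: means_bool => s rs i; rewrite /= rs.
apply: means_lex; first by apply: means_bool => s rs i; rewrite /= rs.
by do 3?[apply: means_lex]; apply: means_array.
Qed.

Lemma means_cell : means E s0 cell_cmp (cell (iarr s0 6) (iarr s0 9)).
Proof. by apply: means_lex; apply: means_array. Qed.

Lemma means_slope : means E s0 slope_cmp (slope s0).
Proof.
move=> s rs _ x y; rewrite /slope_cmp /agree_exp !beval_bite /= rs.
rewrite -!ltNge /slope /slant_of /right_of /up_of.
by case: (rarr s0 0 _ <= _);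
  case: (leP (rarr s0 1 (ireg s x)) (rarr s0 3 (ireg s x)));
   case: (rarr s0 0 (ireg s y) <= _);
     case: (leP (rarr s0 1 (ireg s y)) (rarr s0 3 (ireg s y))).
Qed.

Lemma means_position : means E s0 position_cmp
  (position (group (iarr s0 5) (iarr s0 7) (iarr s0 8) (iarr s0 10) s0)
     (cell (iarr s0 6) (iarr s0 9)) (abscissa s0) (slope s0) ltn).
Proof.
apply: means_lex means_group _; apply: means_lex means_cell _.
apply: means_lex; first by apply: means_real => s rs _ i; rewrite /= rs.
apply: means_lex; first exact: means_rev means_slope.
exact: (means_nat (f := id)).
Qed.

Lemma means_value : means E s0 value_cmp
  (value (group (iarr s0 5) (iarr s0 7) (iarr s0 8) (iarr s0 10) s0)
     (cell (iarr s0 6) (iarr s0 9)) (slope s0)).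
Proof.
apply: means_lex; first exact: means_rev means_group.
exact: means_lex means_cell means_slope.
Qed.
End Meanings.

Section Main.
Local Open Scope nat_scope.

Definition main_body :=
  CSeq (axis 0 2 5 6 7 11)
 (CSeq (axis 1 3 8 9 10 11)
 (CSeq (tree_sort position_cmp) (longest_chain value_cmp))).

Lemma runs_main_body : exists C, forall (R : realType) w n (s : state R),
  n + n + 2 <= w -> ireg s 0 = n -> 0 < n -> (forall k, iarr s 0 k = 0) ->
  let len a b i := `|rarr s b i - rarr s a i|%R in
  (forall i, i < n -> (0 < len 0%N 2%N i)%R) -> (forall i, i < n ->
    (0 < len 1%N 3%N i)%R) ->
  runs w main_body s (C * nlogn n) (fun s' =>
    exists cx sx rx cy sy ry A,
    [/\ axis_spec n (rarr s 0) (len 0 2) cx sx rx,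
        axis_spec n (rarr s 1) (len 1 3) cy sy ry,
        enumerates (position (group cx rx cy ry s) (cell sx sy) (abscissa s) (slope s) ltn) n A
      & chain_marked n (value (group cx rx cy ry s) (cell sx sy) (slope s)) A
          (iarr s' 0)]).
Proof.
have [K1 axis1] := runs_axis 0 2 5 6 7 11.
have [K2 axis2] := runs_axis 1 3 8 9 10 11.
have [K3 sort3] := runs_sort position_cmp.
have [K4 chain4] := runs_longest_chain value_cmp.
exists (K1 + (K2 + (K3 + K4))) => R w n s nw s0n n0 out0 len lx0 ly0.
rewrite !mulnDl.
apply: runs_seq_framed (axis1 R w n s isT isT isT isT isT nw s0n n0 lx0) _ => //.
move=> s1 [rr1 fr1 fa1] spec_x.
have n1 : ireg s1 0 = n by rewrite fr1.
have ly1 i : (i < n) -> (0 < `|rarr s1 3 i - rarr s1 1 i|)%R by rewrite rr1;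
  apply: ly0.
apply: runs_seq_framed (axis2 R w n s1 isT isT isT isT isT nw n1 n0 ly1) _ => //.
move=> s2 [rr2 fr2 fa2]; rewrite rr1 => spec_y.
have n2 : ireg s2 0 = n by rewrite fr2.
have rs2 : rarr s2 = rarr s by rewrite rr2.
have m2 := @means_position R s2 [:: 1; 2] isT.
apply: runs_seq_framed (sort3 R w n _ s2 (sw_position _ _ _ _ _ _ _) _ nw n2 m2) _ => //.
  move=> a b ab; do 3!apply: lex_total; exact: lex_ltn_total.
move=> s3 [rr3 fr3 fa3]; set A := iarr s3 2 => enA.
have n3 : ireg s3 0 = n by rewrite fr3.
have m3 := @means_value R s3 [:: 0; 3; 4] isT.
have rs3 : rarr s3 = rarr s by rewrite rr3.
have Aneq i j : i < j < n -> A i != A j :=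
  enumerates_neq (sw_position _ _ _ _ _ _ _) enA.
have out3 k : iarr s3 0 k = 0 by rewrite fa3 // fa2 // fa1.
have fin := chain4 R w n _ A s3 (sw_value _ _ _ _ _ _ _) nw enA.1 Aneq m3 n3 n0 erefl out3.
apply: runs_weaken fin (leqnn _) _ => s4 ch.
exists (iarr s1 5), (iarr s1 6), (iarr s1 7), (iarr s2 8), (iarr s2 9),
  (iarr s2 10), A.
split=> //.
  by move: enA; rewrite (fa2 5) // (fa2 6) // (fa2 7) //
    /position /group /abscissa /slope /slant_of /right_of /up_of rs2.
move: ch; rewrite !fa3 // (fa2 5) // (fa2 6) // (fa2 7) //.
by rewrite /value /group /slope /slant_of /right_of /up_of rs3.
Qed.

Definition main := CIf (ILe (IConst 1) (IReg 0)) main_body CSkip.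

End Main.

Section Asymptotics.
Local Open Scope ring_scope.
Local Open Scope classical_set_scope.

Lemma trunc_log_le_log2 (R : realType) n : (0 < n)%N ->
  (trunc_log 2 n)%:R <= log2 n%:R :> R.
Proof.
move=> n0; have ln2 : 0 < ln 2 :> R by rewrite ln_gt0 // ltr1n.
rewrite /log2 ler_pdivlMr // mulr_natl -lnXn // ler_ln ?posrE ?exprn_gt0 ?ltr0n //.
by rewrite -natrX ler_nat trunc_logP.
Qed.

Lemma nlogn_bigO (R : realType) (a b : nat) :
  (fun n : nat => (a + b * nlogn n)%:R : R) =O_\oo
  (fun n : nat => n%:R * log2 n%:R ^+ 2 : R).
Proof.
apply/eqO_exP; exists (a + 4 * b).+1%:R; first by rewrite ltr0n.
near=> n.
have n2 : (2 <= n)%N by near: n; exact: nbhs_infty_ge.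
have l1 : 1 <= log2 n%:R :> R.
  have log2_2 : log2 2 = 1 :> R by rewrite -[2]mulr1 log2_double // log2_1 addr0.
  by rewrite -[leLHS]log2_2; apply: ler_log2 => //; rewrite (ler_nat R 2).
have gl := trunc_log_le_log2 R (ltnW n2).
have N2 : 2 <= n%:R :> R by rewrite ler_nat.
set l := log2 n%:R in l1 gl *; set N : R := n%:R in N2 *.
have l2 : l <= l ^+ 2 by rewrite expr2 ler_peMl // (le_trans ler01).
have Nl : 1 <= N * l ^+ 2.
  by apply: le_trans (le_trans l1 l2) _; rewrite ler_peMl ?sqr_ge0 //; lra.
rewrite !ger0_norm ?ler0n //; last exact: le_trans Nl.
have h : (nlogn n)%:R <= 4 * (N * l ^+ 2).
  have -> : 4 * (N * l ^+ 2) = (2 * N) * (2 * l ^+ 2) by rewrite mulrACA -natrM.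
  by rewrite /nlogn natrM; apply: ler_pM => //; rewrite -natr1; lra.
have ha : a%:R <= a%:R * (N * l ^+ 2) by rewrite ler_peMr.
have hb : b%:R * (nlogn n)%:R <= b%:R * (4 * (N * l ^+ 2)) by rewrite ler_wpM2l.
move: ha hb Nl; rewrite -[(a + _).+1%:R]natr1 !natrD !natrM.
by set Z := N * _; lra.
Unshelve. all: by end_near.
Qed.
End Asymptotics.

Local Open Scope ring_scope.
Local Open Scope classical_set_scope.

Theorem theorem2 (R : realType) :
  exists (p : com) (c : nat) (T : nat -> nat),
    ((fun n : nat => (T n)%:R : R) =O_\oo
       (fun n : nat => n%:R * log2 n%:R ^+ 2 : R))
    /\ forall (n : nat) (L : 'I_n -> ell R), injective L ->
         exists (t : nat) (s : state R),
           [/\ exec ((n + 2) ^ c)%N p (input_state L) t s,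
               (t <= T n)%N,
               independent (intersection_graph L) (output_set n s) &
               (independence_number (intersection_graph L))%:R
                 / (36 * log2 (2 * d_x L) * log2 (2 * d_y L))
               <= (#|output_set n s|%:R : R)].
Proof.
have [C runC] := runs_main_body.
exists main, 2%N, (fun n => 5 + C * nlogn n)%N; split; first exact: nlogn_bigO.
move=> n L _; set w := ((n + 2) ^ 2)%N; pose s0 := input_state L.
case: (posnP n) => [n0|n_gt0].
  exists 5%N, s0; split.
  - by rewrite -[5%N]/(3 + 1).+1; apply: ExecIfFalse; [rewrite /= n0|constructor].
  - by [].
  - by apply/'forall_implyP => i; have := ltn_ord i; rewrite [X in (_ < X)%N]n0.
  - suff -> : independence_number (intersection_graph L) = 0%N by rewrite mul0r ler0n.
    apply/eqP; rewrite -leqn0; apply/bigmax_leqP => I _.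
    by apply: leq_trans (max_card _) _; rewrite card_ord n0.
have pos_x i : 0 < horizontal_length (L i) by rewrite normr_gt0 subr_eq0 ell_xhP.
have pos_y i : 0 < vertical_length (L i) by rewrite normr_gt0 subr_eq0 ell_yvP.
have nw : (n + n + 2 <= w)%N by rewrite /w expnS expn1; nia.
have inp a i (ni : (i < n)%N) : rarr s0 a i = input_coord a (L (Ordinal ni)).
  by rewrite -(input_rarr L).
have [|||t [s1 [ex le]]] := runC R w n s0 nw erefl n_gt0.
- by [].
- by move=> i ni; rewrite !inp; apply: pos_x.
- by move=> i ni; rewrite !inp; apply: pos_y.
move=> [cx [sx [rx [cy [sy [ry [A [spec_x spec_y enA ch]]]]]]]].
have [cmpO [m [lb [lbm lbV mO]]]] :=
  chain_marked_items (sw_position _ _ _ _ _ _ _) (sw_value _ _ _ _ _ _ _) enA ch.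
exists (3 + t).+1, s1; split.
- exact: ExecIfTrue.
- by rewrite addSn ltnS; lia.
- apply: (independent_chain spec_x spec_y) => i j; rewrite !inE => mi mj ij.
  exact: cmpO.
have bound := independence_number_bound spec_x spec_y lbm lbV.
have [_ _ sepx _ _] := spec_x; have [_ _ sepy _ _] := spec_y.
have Kx : #|x_class spec_x @: [set: 'I_n]%SET|%:R <= log2 (2 * d_x L).
  apply: card_classes => // i j.
  have lenE (k : 'I_n) : horizontal_length (L k) = `|rarr s0 2 k - rarr s0 0 k|.
    by rewrite !input_rarr.
  rewrite !lenE; have [h|h|h] := sepx i j (ltn_ord i) (ltn_ord j).
  - by constructor 1; apply: val_inj.
  - by constructor 2.
  - by constructor 3.
have Ky : #|y_class spec_y @: [set: 'I_n]%SET|%:R <= log2 (2 * d_y L).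
  apply: card_classes => // i j.
  have lenE (k : 'I_n) : vertical_length (L k) = `|rarr s0 3 k - rarr s0 1 k|.
    by rewrite !input_rarr.
  rewrite !lenE; have [h|h|h] := sepy i j (ltn_ord i) (ltn_ord j).
  - by constructor 1; apply: val_inj.
  - by constructor 2.
  - by constructor 3.
have Kx1 : (1 <= #|x_class spec_x @: [set: 'I_n]%SET|)%N.
  by rewrite card_gt0; apply/set0Pn; exists (x_class spec_x (Ordinal n_gt0));
    rewrite imset_f.
have Ky1 : (1 <= #|y_class spec_y @: [set: 'I_n]%SET|)%N.
  by rewrite card_gt0; apply/set0Pn; exists (y_class spec_y (Ordinal n_gt0));
    rewrite imset_f.
have lx0 : 0 < log2 (2 * d_x L) by apply: lt_le_trans Kx; rewrite ltr0n.
have ly0 : 0 < log2 (2 * d_y L) by apply: lt_le_trans Ky; rewrite ltr0n.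
rewrite ler_pdivrMr; last by apply: mulr_gt0 ly0; apply: mulr_gt0 lx0; rewrite ltr0n.
apply: le_trans (_ : (36 * #|x_class spec_x @: [set: 'I_n]%SET| *
  #|y_class spec_y @: [set: 'I_n]%SET| * #|output_set n s1|)%:R <= _).
  by rewrite ler_nat (leq_trans bound) // leq_mul2l mO orbT.
rewrite !natrM [leLHS]mulrC ler_wpM2l //.
by apply: ler_pM => //; [rewrite mulr_ge0|rewrite ler_wpM2l].
Qed.
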